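(* There is a universal constant $C$ such that the following holds. Let $H$ be a separable infinite-dimensional Hilbert space, $E$ a Banach space, and let $\Phi\in\gamma(L^2(\mathbb{R}_+;H),E)$. For all $b>0$ the family $$\mathscr{T}_b^\Phi:=\{\widehat\Phi(\lambda):\ \mathrm{Re}\,\lambda\ge b\}$$ is uniformly $\gamma$-radonifying in $\gamma(H,E)$, and $$\|\mathscr{T}_b^\Phi\|_{\mathrm{unif}\text{-}\gamma}\le\frac{C}{\sqrt b}\,\|\Phi\|_{\gamma(L^2(\mathbb{R}_+;H),E)}.$$
   Context: Spaces are complex. Let $(\gamma_k)_{k\ge1}$ be a Gaussian sequence, i.e. independent real-valued standard Gaussian random variables on a probability space $(\Omega,\mathbb{P})$, with expectation $\mathbb{E}$. For a separable Hilbert space $K$, a linear operator $T:K\to E$ is $\gamma$-radonifying if for some (equivalently, every) orthonormal basis $(k_j)_j$ of $K$ the sum $\sum_j\gamma_jTk_j$ converges in $L^2(\Omega;E)$; $\gamma(K,E)$ is the Banach space of such operators, with norm $\|T\|_{\gamma(K,E)}^2=\mathbb{E}\|\sum_j\gamma_jTk_j\|^2$ (independent of the basis). A set $\mathscr{T}$ of bounded linear operators from $H$ to $E$ is uniformly $\gamma$-radonifying if for all orthonormal bases $(h_k)_{k\ge1}$ of $H$ and all sequences $(T_k)_{k\ge1}$ in $\mathscr{T}$ the sum $\sum_{k\ge1}\gamma_kT_kh_k$ converges in $L^2(\Omega;E)$; then $\|\mathscr{T}\|_{\mathrm{unif}\text{-}\gamma}^2:=\sup\mathbb{E}\|\sum_{k\ge1}\gamma_kT_kh_k\|^2$,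 the supremum being over all orthonormal bases $(h_k)$ of $H$ and all sequences $(T_k)$ in $\mathscr{T}$. The Laplace transform of $\Phi\in\gamma(L^2(\mathbb{R}_+;H),E)$ is the function $\widehat\Phi:\mathbb{C}_+\to\gamma(H,E)$, $\mathbb{C}_+=\{\mathrm{Re}\,\lambda>0\}$, defined by $\widehat\Phi(\lambda)h:=\Phi(e_\lambda\otimes h)$ for $h\in H$, where $e_\lambda(t)=e^{-\lambda t}$ and $(f\otimes h)(t)=f(t)h$. *)

(* Defs.v *)
From HB Require Import structures.
From mathcomp Require Import all_boot all_order all_algebra ring lra.
From mathcomp Require Import complex.
From mathcomp Require Import all_classical all_reals all_analysis.
From mathcomp Require Import measurable_realfun.

Set Implicit Arguments.
Unset Strict Implicit.
Unset Printing Implicit Defensive.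

Import Order.TTheory GRing.Theory Num.Theory.
Import numFieldNormedType.Exports HBSimple.

Local Open Scope classical_set_scope.
Local Open Scope ring_scope.
Local Open Scope complex_scope.

(* The inner product is linear in its first argument. *)
HB.mixin Record isInnerProduct (R : realType) K of GRing.Lmodule R[i] K := {
  inner : K -> K -> R[i];
  inner_linearl : forall z a x y,
    inner (a *: x + y) z = a * inner x z + inner y z;
  inner_conj : forall x y, inner y x = conjc (inner x y);
  inner_gt0 : forall x, x != 0 -> 0 < inner x x
}.

#[short(type="innerProductType")]
HB.structure Definition InnerProduct (R : realType) :=
  {K of GRing.Lmodule R[i] K & isInnerProduct R K}.

HB.mixin Record isHilbert (R : realType) H
    of CompleteNormedModule R[i] H & InnerProduct R H := {
  inner_normE : forall x : H, inner x x = `|x| ^+ 2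
}.

#[short(type="hilbertType")]
HB.structure Definition Hilbert (R : realType) :=
  {H of CompleteNormedModule R[i] H & InnerProduct R H & isHilbert R H}.


Section real_norm.
Context {R : realType} {V : normedModType R[i]}.
Implicit Types x y : V.

Definition rnorm x : R := complex.Re `|x|.

Lemma rnormE x : `|x| = (rnorm x)%:C.
Proof.
by rewrite /rnorm; have := normr_ge0 x; case: `|x| => a b; rewrite lecE /= => /andP[/eqP->].
Qed.

Lemma rnorm_ge0 x : 0 <= rnorm x.
Proof. by have := normr_ge0 x; rewrite rnormE lecR. Qed.

Lemma rnormD x y : rnorm (x + y) <= rnorm x + rnorm y.
Proof. by have := ler_normD x y; rewrite !rnormE -rmorphD lecR. Qed.

Lemma rnormN x : rnorm (- x) = rnorm x.
Proof. by rewrite /rnorm normrN. Qed.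

Lemma rnormB_dist x y : `|rnorm x - rnorm y| <= rnorm (x - y).
Proof.
have xy : rnorm x <= rnorm (x - y) + rnorm y by rewrite -{1}(subrK y x) rnormD.
have yx : rnorm y <= rnorm (x - y) + rnorm x.
  by rewrite -(rnormN (x - y)) opprB -{1}(subrK x y) rnormD.
by rewrite ler_distl lerBlDl yx [rnorm y + _]addrC.
Qed.

Lemma rnormZ (a : R[i]) x : rnorm (a *: x) = complex.Re `|a| * rnorm x.
Proof. rewrite {1}/rnorm normrZ rnormE.
by case: a => a b; rewrite normc_def /= mulr0 subr0. Qed.

Lemma cvg_rnorm (f : nat -> V) (l : V) :
  f n @[n --> \oo] --> l -> rnorm (f n) @[n --> \oo] --> rnorm l.
Proof.
move=> fl; apply/cvgrPdist_lt => e e0.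
have e0' : 0 < e%:C :> R[i] by rewrite ltcR.
move/cvgrPdist_lt : fl => /(_ _ e0'); apply: filterS => n.
by rewrite rnormE ltcR; apply: le_lt_trans; exact: rnormB_dist.
Qed.

End real_norm.

Section strong_measurability.
Context d (T : measurableType d).

Definition simple_fun (V : Type) (s : T -> V) :=
  finite_set (range s) /\ forall v, measurable (s @^-1` [set v]).

Lemma simple_fun2 (U V W : Type) (F : U -> V -> W) s t :
  simple_fun s -> simple_fun t -> simple_fun (fun x => F (s x) (t x)).
Proof.
move=> [fs ms] [ft mt]; split.
  apply: (@sub_finite_set _ _ [set F a b | a in range s & b in range t]).
    by move=> _ [x _ <-]; exists (s x); [exists x|exists (t x) => //; exists x].
  exact: finite_image2.
move=> v.
have -> : (fun x => F (s x) (t x)) @^-1` [set v] =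
    \bigcup_(p in (range s `*` range t) `&` [set p | F p.1 p.2 = v])
      ((s @^-1` [set p.1]) `&` (t @^-1` [set p.2])).
  apply/seteqP; split=> [x /= Fv|x [[a b] /= [_ Fv]] [sa tb]].
    by exists (s x, t x) => //=; split => //; split; exists x.
  by rewrite sa tb.
apply: fin_bigcup_measurable => [|p _]; last exact: measurableI.
by apply: finite_setIl; exact: finite_setX.
Qed.

Lemma simple_fun1 (U W : Type) (F : U -> W) s :
  simple_fun s -> simple_fun (fun x => F (s x)).
Proof. by move=> ss; exact: (simple_fun2 (fun a _ => F a) ss ss). Qed.

Lemma simple_measurable (R : realType) (s : T -> R) :
  simple_fun s -> measurable_fun setT s.
Proof.
move=> [fs ms] _ B mB; rewrite setTI.
have -> : s @^-1` B = \bigcup_(a in range s `&` B) (s @^-1` [set a]).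
  apply/seteqP; split=> [x Bx|x [a [_ Ba] /= ->]//].
  by exists (s x) => //; split => //; exists x.
by apply: fin_bigcup_measurable => //; exact: finite_setIl.
Qed.

Context {R : realType} {V : normedModType R[i]}.

(* Pointwise everywhere limit of simple functions: up to equality almost
   everywhere this is Bochner's strong measurability, and it makes [rnorm \o f]
   measurable without completing the sigma-algebra. *)
Definition strongly_measurable (f : T -> V) :=
  exists2 s : nat -> T -> V, (forall n, simple_fun (s n)) &
    forall x, s n x @[n --> \oo] --> f x.

Lemma strongly_measurable_cst v : strongly_measurable (fun=> v).
Proof.
exists (fun _ _ => v) => [_|x]; last exact: cvg_cst.
split; first by apply: (sub_finite_set _ (finite_set1 v)) => _ [x _ <-].
move=> w; have [->|wv] := eqVneq w v.
  by rewrite (_ : _ @^-1` _ = setT)//; exact/seteqP.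
rewrite (_ : _ @^-1` _ = set0)//; apply/seteqP; split=> // x /= vw.
by rewrite vw eqxx in wv.
Qed.

Lemma strongly_measurable_lin a (f g : T -> V) :
  strongly_measurable f -> strongly_measurable g ->
  strongly_measurable (fun x => a *: f x + g x).
Proof.
move=> [s ss sf] [t st tg].
exists (fun n x => a *: s n x + t n x) => [n|x].
  exact: (simple_fun2 (fun u v => a *: u + v)).
by apply: cvgD => //; exact: cvgZl_tmp.
Qed.

Lemma measurable_rnorm (f : T -> V) :
  strongly_measurable f -> measurable_fun setT (fun x => rnorm (f x)).
Proof.
move=> [s ss sf].
apply: (@measurable_fun_cvg _ _ _ _ (fun n x => rnorm (s n x))) => //.
  by move=> n; apply: simple_measurable; exact: simple_fun1.
by move=> x _; exact: cvg_rnorm.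
Qed.

Lemma strongly_measurable_scale (f : T -> R) (v : V) :
  measurable_fun setT f -> strongly_measurable (fun x => (f x)%:C *: v).
Proof.
move=> mf; have /measurable_EFinP mf' := mf.
have [s sf] := approximation_sfun measurableT mf'.
exists (fun n x => (s n x)%:C *: v) => [n|x].
  apply: (@simple_fun1 _ _ (fun r : R => r%:C *: v)); split.
    exact: fimfunP.
  by move=> r; exact: measurable_sfunP.
have {}sf : s n x @[n --> \oo] --> f x.
  by have /fine_cvgP[_] : (s n x)%:E @[n --> \oo] --> (f x)%:E := sf x Logic.I.
apply: cvgZr_tmp.
apply/cvgrPdist_lt => -[e e'] /[dup]; rewrite {1}ltcE /= => /andP[/eqP-> e0] _.
move/cvgrPdist_lt : sf => /(_ _ e0); apply: filterS => n.
by rewrite -rmorphB normc_def /= expr0n/= addr0 sqrtr_sqr ltcR.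
Qed.

End strong_measurability.

Section inner_product_theory.
Context {R : realType} {K : innerProductType R}.
Implicit Types x y z : K.

Lemma innerDl x y z : inner (x + y) z = inner x z + inner y z.
Proof. by rewrite -[x in LHS]scale1r inner_linearl mul1r. Qed.

Lemma inner0l z : inner 0 z = 0 :> R[i].
Proof.
have /eqP := innerDl 0 0 z; rewrite addr0.
by rewrite -[X in X == _]addr0 (inj_eq (addrI _)) => /eqP.
Qed.

Lemma innerZl a x z : inner (a *: x) z = a * inner x z.
Proof. by rewrite -[a *: x]addr0 inner_linearl inner0l addr0. Qed.

Lemma innerDr x y z : inner z (x + y) = inner z x + inner z y.
Proof.
by rewrite (inner_conj (x + y)) innerDl rmorphD/= -!inner_conj.
Qed.

Lemma innerZr a x z : inner z (a *: x) = conjc a * inner z x.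
Proof. by rewrite (inner_conj (a *: x)) innerZl rmorphM/= -inner_conj. Qed.

End inner_product_theory.

Section L2_space.
Context d (T : measurableType d) (R : realType).
Variables (mu : {measure set T -> \bar R}) (H : hilbertType R).
Implicit Types f g : T -> H.

Definition square_integrable f :=
  strongly_measurable f /\ (\int[mu]_t ((rnorm (f t)) ^+ 2)%:E < +oo)%E.

Lemma square_integrableP f : square_integrable f ->
  mu.-integrable setT (fun t => ((rnorm (f t)) ^+ 2)%:E).
Proof.
move=> [mf fy]; apply/integrableP; split.
  by apply/measurable_EFinP/measurable_funX; exact: measurable_rnorm.
by under eq_integral do rewrite gee0_abs ?lee_fin ?sqr_ge0//.
Qed.

Lemma square_integrable_lin a f g :
  square_integrable f -> square_integrable g ->
  square_integrable (fun t => a *: f t + g t).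
Proof.
move=> sf sg; have mfg := strongly_measurable_lin a sf.1 sg.1.
split=> //; set c := complex.Re `|a|.
have c0 : 0 <= c by have := normr_ge0 a; rewrite /c lecE => /andP[].
have If := integrableZl measurableT (2 * c ^+ 2) (square_integrableP sf).
have Ig := integrableZl measurableT 2 (square_integrableP sg).
have /integrableP[_] := integrableD measurableT If Ig.
apply: le_lt_trans; apply: ge0_le_integral => //=.
- by move=> t _; rewrite lee_fin sqr_ge0.
- by apply/measurable_EFinP/measurable_funX; exact: measurable_rnorm.
- apply/measurable_EFinP/measurableT_comp => //; apply: measurable_funD.
    apply: measurable_funM => //; apply: measurable_funX.
    exact: measurable_rnorm sf.1.
  apply: measurable_funM => //; apply: measurable_funX.
  exact: measurable_rnorm sg.1.
move=> t _; rewrite lee_fin -/c; apply: le_trans (ler_norm _).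
have /= := rnormD (a *: f t) (g t); rewrite rnormZ -/c => h.
set u := rnorm (f t) in h *; set v := rnorm (g t) in h *.
have w0 := rnorm_ge0 (a *: f t + g t).
have u0 : 0 <= u := rnorm_ge0 _.
have v0 : 0 <= v := rnorm_ge0 _.
apply: (@le_trans _ _ ((c * u + v) ^+ 2)); first by rewrite ler_sqr ?nnegrE ?addr_ge0 ?mulr_ge0.
have := sqr_ge0 (c * u - v); nra.
Qed.

Lemma inner_rnorm (x : H) : inner x x = (rnorm x ^+ 2)%:C.
Proof. by rewrite inner_normE rnormE rmorphXn. Qed.

Lemma Re_innerE (x y : H) : complex.Re (inner x y) =
  4^-1 * (rnorm (1 *: x + y) ^+ 2) - 4^-1 * (rnorm ((- 1) *: x + y) ^+ 2).
Proof.
have E (z : H) : rnorm z ^+ 2 = complex.Re (inner z z) by rewrite inner_rnorm.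
rewrite !E !(innerDl, innerDr, innerZl, innerZr) (inner_conj x y).
by case: (inner x y) => p q; case: (inner x x) => ? ?; case: (inner y y) => ? ? /=; field.
Qed.

Lemma Im_innerE (x y : H) :
  complex.Im (inner x y) = complex.Re (inner x ('i *: y)).
Proof. by rewrite innerZr; case: inner => a b /=; ring. Qed.

Lemma integrable_Re_inner f g : square_integrable f -> square_integrable g ->
  mu.-integrable setT (fun t => (complex.Re (inner (f t) (g t)))%:E).
Proof.
move=> sf sg.
have I1 := square_integrableP (square_integrable_lin 1 sf sg).
have I2 := square_integrableP (square_integrable_lin (- 1) sf sg).
have := integrableB measurableT (integrableZl measurableT 4^-1 I1)
  (integrableZl measurableT 4^-1 I2).
by apply: eq_integrable => // t _; rewrite /= Re_innerE.
Qed.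

Lemma square_integrable0 : square_integrable (fun=> 0).
Proof.
split; first exact: strongly_measurable_cst.
by under eq_integral do rewrite /rnorm normr0 expr0n/=; rewrite integral0.
Qed.

Lemma integrable_Im_inner f g : square_integrable f -> square_integrable g ->
  mu.-integrable setT (fun t => (complex.Im (inner (f t) (g t)))%:E).
Proof.
move=> sf sg.
have := integrable_Re_inner sf (square_integrable_lin 'i sg square_integrable0).
by apply: eq_integrable => // t _ /=; rewrite addr0 Im_innerE.
Qed.

Definition L2fun_pred : {pred (T -> H)} := fun f => `[< square_integrable f >].

Lemma L2fun_submod_closed : submod_closed L2fun_pred.
Proof.
split; first by apply/asboolP; exact: square_integrable0.
by move=> a f g /asboolP sf /asboolP sg; apply/asboolP/square_integrable_lin.
Qed.

HB.instance Definition _ :=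
  GRing.isSubmodClosed.Build _ _ L2fun_pred L2fun_submod_closed.

Definition L2fun := {f : T -> H | f \in L2fun_pred}.
HB.instance Definition _ := SubType.on L2fun.
HB.instance Definition _ := Choice.on L2fun.
HB.instance Definition _ := [SubChoice_isSubLmodule of L2fun by <:].


Definition ae_eqL2 (F G : L2fun) := `[< {ae mu, forall t, val F t = val G t} >].

Let ae_eqL2_refl : reflexive ae_eqL2.
Proof. by move=> F; apply/asboolP; exact: aeW. Qed.

Let ae_eqL2_sym : symmetric ae_eqL2.
Proof.
by move=> F G; apply/asboolP/asboolP; apply: filterS => t ->.
Qed.

Let ae_eqL2_trans : transitive ae_eqL2.
Proof.
move=> G F K /asboolP FG /asboolP GK; apply/asboolP.
by apply: filterS2 FG GK => t -> ->.
Qed.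

Canonical ae_eqL2_equiv :=
  EquivRel ae_eqL2 ae_eqL2_refl ae_eqL2_sym ae_eqL2_trans.

Local Open Scope quotient_scope.

Definition L2 := {eq_quot ae_eqL2}.
HB.instance Definition _ := Choice.on L2.
HB.instance Definition _ := EqQuotient.on L2.

Lemma L2_eqP (F G : L2fun) :
  \pi_L2 F = \pi_L2 G <-> {ae mu, forall t, val F t = val G t}.
Proof.
by split=> [/eqP|FG]; [|apply/eqP]; rewrite eqmodE; [move=> /asboolP|apply/asboolP].
Qed.

Lemma L2_reprP (F : L2fun) : {ae mu, forall t, val (repr (\pi_L2 F)) t = val F t}.
Proof. by apply/L2_eqP; rewrite reprK. Qed.

Definition addL2 (F G : L2) : L2 := \pi_L2 (repr F + repr G).
Definition oppL2 (F : L2) : L2 := \pi_L2 (- repr F).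
Definition scaleL2 (a : R[i]) (F : L2) : L2 := \pi_L2 (a *: repr F).

Lemma addL2E F G : addL2 (\pi_L2 F) (\pi_L2 G) = \pi_L2 (F + G).
Proof.
apply/L2_eqP; apply: filterS2 (L2_reprP F) (L2_reprP G) => t Ft Gt.
by rewrite !raddfD/= !fctE; move: Ft Gt => /= -> ->.
Qed.

Lemma oppL2E F : oppL2 (\pi_L2 F) = \pi_L2 (- F).
Proof.
by apply/L2_eqP; apply: filterS (L2_reprP F) => t Ft; rewrite !raddfN/= !fctE; move: Ft => /= ->.
Qed.

Lemma scaleL2E a F : scaleL2 a (\pi_L2 F) = \pi_L2 (a *: F).
Proof.
by apply/L2_eqP; apply: filterS (L2_reprP F) => t Ft; rewrite !linearZ/= !fctE; move: Ft => /= ->.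
Qed.

Let addL2A : associative addL2.
Proof. by elim/quotW=> F; elim/quotW=> G; elim/quotW=> K; rewrite (addL2E F G) (addL2E G K) !addL2E addrA. Qed.
Let addL2C : commutative addL2.
Proof. by elim/quotW=> F; elim/quotW=> G; rewrite !addL2E addrC. Qed.
Let add0L2 : left_id (\pi_L2 0) addL2.
Proof. by elim/quotW=> F; rewrite addL2E add0r. Qed.
Let addNL2 : left_inverse (\pi_L2 0) oppL2 addL2.
Proof. by elim/quotW=> F; rewrite (oppL2E F) addL2E addNr. Qed.

HB.instance Definition _ := GRing.isZmodule.Build L2 addL2A addL2C add0L2 addNL2.

Let scaleL2A a b F : scaleL2 a (scaleL2 b F) = scaleL2 (a * b) F.
Proof. by elim/quotW: F => F; rewrite (scaleL2E b) !scaleL2E scalerA. Qed.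
Let scale1L2 : left_id 1 scaleL2.
Proof. by elim/quotW=> F; rewrite scaleL2E scale1r. Qed.
Let scaleL2DR : right_distributive scaleL2 +%R.
Proof.
move=> a; elim/quotW=> F; elim/quotW=> G.
rewrite (scaleL2E a F) (scaleL2E a G).
transitivity (scaleL2 a (addL2 (\pi_L2 F) (\pi_L2 G))); first by [].
by rewrite addL2E scaleL2E scalerDr -addL2E.
Qed.
Let scaleL2DL F : {morph scaleL2^~ F : a b / a + b}.
Proof.
move=> a b; elim/quotW: F => F.
by rewrite (scaleL2E a F) (scaleL2E b F) (scaleL2E (a + b)) scalerDl -addL2E.
Qed.

HB.instance Definition _ := GRing.Zmodule_isLmodule.Build R[i] L2
  scaleL2A scale1L2 scaleL2DR scaleL2DL.

Lemma pi_L2_lin a F G : a *: \pi_L2 F + \pi_L2 G = \pi_L2 (a *: F + G).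
Proof. by rewrite -addL2E -scaleL2E. Qed.

Definition cintegral (f : T -> R[i]) : R[i] :=
  (\int[mu]_t complex.Re (f t)) +i* (\int[mu]_t complex.Im (f t)).

Definition innerL2 (F G : L2) : R[i] :=
  cintegral (fun t => inner (val (repr F) t) (val (repr G) t)).

Lemma L2funP (F : L2fun) : square_integrable (val F).
Proof. by apply/asboolP; exact: valP F. Qed.

Lemma innerL2E F G :
  innerL2 (\pi_L2 F) (\pi_L2 G) = cintegral (fun t => inner (val F t) (val G t)).
Proof.
rewrite /innerL2 /cintegral /Rintegral; congr (fine _ +i* fine _).
- apply: ae_eq_integral => //.
  + by have /integrableP[] := integrable_Re_inner
      (L2funP (repr (\pi_L2 F))) (L2funP (repr (\pi_L2 G))).
  + by have /integrableP[] := integrable_Re_inner (L2funP F) (L2funP G).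
  + by apply: filterS2 (L2_reprP F) (L2_reprP G) => t -> ->.
- apply: ae_eq_integral => //.
  + by have /integrableP[] := integrable_Im_inner
      (L2funP (repr (\pi_L2 F))) (L2funP (repr (\pi_L2 G))).
  + by have /integrableP[] := integrable_Im_inner (L2funP F) (L2funP G).
  + by apply: filterS2 (L2_reprP F) (L2_reprP G) => t -> ->.
Qed.

Lemma innerL2_linearl K a F G :
  innerL2 (a *: F + G) K = a * innerL2 F K + innerL2 G K.
Proof.
elim/quotW: F => F; elim/quotW: G => G; elim/quotW: K => K.
rewrite pi_L2_lin !innerL2E /cintegral.
have RF := integrable_Re_inner (L2funP F) (L2funP K).
have RG := integrable_Re_inner (L2funP G) (L2funP K).
have IF := integrable_Im_inner (L2funP F) (L2funP K).
have IG := integrable_Im_inner (L2funP G) (L2funP K).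
set rF := fun t => complex.Re (inner (val F t) (val K t)) in RF *.
set rG := fun t => complex.Re (inner (val G t) (val K t)) in RG *.
set jF := fun t => complex.Im (inner (val F t) (val K t)) in IF *.
set jG := fun t => complex.Im (inner (val G t) (val K t)) in IG *.
have IZ c h : mu.-integrable setT (EFin \o h) ->
    mu.-integrable setT (EFin \o (fun t => c * h t)).
  by move=> Ih; have := integrableZl measurableT c Ih.
have ID h k : mu.-integrable setT (EFin \o h) -> mu.-integrable setT (EFin \o k) ->
    mu.-integrable setT (EFin \o (fun t => h t + k t)).
  by move=> Ih Ik; have := integrableD measurableT Ih Ik.
have E t : val (a *: F + G) t = a *: val F t + val G t.
  by [].
case: a E => a b /= E; congr (_ +i* _).
- rewrite (@eq_Rintegral _ _ _ mu setT (fun t => (a * rF t + (- b) * jF t) + rG t)).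
    rewrite RintegralD//; [|by apply: ID; exact: IZ].
    by rewrite RintegralD ?IZ// !RintegralZl// mulNr.
  move=> t _; rewrite E inner_linearl /rF /jF /rG.
  by case: (inner (val F t) _) => ? ?; case: (inner (val G t) _) => ? ? /=; ring.
- rewrite (@eq_Rintegral _ _ _ mu setT (fun t => (a * jF t + b * rF t) + jG t)).
    rewrite RintegralD//; [|by apply: ID; exact: IZ].
    by rewrite RintegralD ?IZ// !RintegralZl.
  move=> t _; rewrite E inner_linearl /rF /jF /jG.
  by case: (inner (val F t) _) => ? ?; case: (inner (val G t) _) => ? ? /=; ring.
Qed.

Lemma innerL2_conj F G : innerL2 G F = conjc (innerL2 F G).
Proof.
elim/quotW: F => F; elim/quotW: G => G; rewrite !innerL2E /cintegral/=.
congr (_ +i* _).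
  by apply: eq_Rintegral => t _; rewrite inner_conj; case: inner.
rewrite -mulN1r -RintegralZl//; last exact: integrable_Im_inner (L2funP F) (L2funP G).
by apply: eq_Rintegral => t _; rewrite inner_conj mulN1r; case: inner.
Qed.

Lemma innerL2_gt0 F : F != 0 -> 0 < innerL2 F F.
Proof.
elim/quotW: F => F F0; rewrite innerL2E /cintegral ltcE/=.
have -> : \int[mu]_t complex.Im (inner (val F t) (val F t)) = 0.
  rewrite (@eq_Rintegral _ _ _ mu setT (fun=> 0)); last by move=> t _; rewrite inner_rnorm.
  by rewrite /Rintegral integral0.
rewrite eqxx /= lt_neqAle Rintegral_ge0 ?andbT; last first.
  by move=> t _; rewrite inner_rnorm/= sqr_ge0.
apply: contra F0 => /eqP F0; apply/eqP/L2_eqP.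
have /integrableP[mF _] := integrable_Re_inner (L2funP F) (L2funP F).
have F0' : (\int[mu]_t (complex.Re (inner (val F t) (val F t)))%:E = 0)%E.
  rewrite -[LHS]fineK; last first.
    exact: integrable_fin_num (integrable_Re_inner (L2funP F) (L2funP F)).
  by move: F0; rewrite /Rintegral => <-.
have : {ae mu, forall t, setT t ->
    (complex.Re (inner (val F t) (val F t)))%:E = 0%E}.
  apply/ae_eq_integral_abs => //; rewrite -[RHS]F0'; apply: eq_integral => t _.
  by rewrite gee0_abs// lee_fin inner_rnorm/= sqr_ge0.
apply: filterS => t /(_ Logic.I) [] /eqP.
rewrite inner_rnorm/= sqrf_eq0 => /eqP nF.
by apply/eqP; rewrite -normr_eq0 rnormE nF.
Qed.

HB.instance Definition _ :=
  isInnerProduct.Build R L2 innerL2_linearl innerL2_conj innerL2_gt0.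

(* The class of [f] if [f] is square integrable, and 0 otherwise. *)
Definition toL2 f : L2 := \pi_L2 (insubd (0 : L2fun) f).

Lemma toL2_reprP f : square_integrable f ->
  {ae mu, forall t, val (repr (toL2 f)) t = f t}.
Proof.
move=> sf; apply: filterS (L2_reprP (insubd (0 : L2fun) f)) => t ->.
by rewrite insubdK//; exact/asboolP.
Qed.

End L2_space.

Section Laplace_transform.
Context {R : realType}.

Definition Rplus_measure : {measure set (measurableTypeR R) -> \bar R} :=
  mrestr lebesgue_measure (measurable_itv `[0%R, +oo[).

Lemma ge0_integral_Rplus (f : R -> \bar R) : measurable_fun setT f ->
  (forall t, 0 <= f t)%E ->
  (\int[Rplus_measure]_t f t = \int[lebesgue_measure]_(t in `[0%R, +oo[) f t)%E.
Proof.
pose D : set (measurableTypeR R) := `[0%R, +oo[%classic.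
have mD : measurable D by exact: measurable_itv.
have RE A : Rplus_measure A = lebesgue_measure (A `&` D) by [].
move=> mf f0; rewrite (@ge0_negligible_integral _ _ _ _ setT (~` D))//=.
- rewrite setTD setCK; apply: eq_measure_integral => A mA A0.
  by rewrite [LHS]RE setIidl.
- by apply: measurableC.
- by rewrite [LHS]RE setICl measure0.
Qed.

Definition L2Rplus (H : hilbertType R) := L2 Rplus_measure H.

(* [e_ lam t] is exp (- lam t), split into modulus and argument. *)
Definition e_ (lam : R[i]) (t : R) : R[i] :=
  (expR (- (complex.Re lam * t)))%:C *
  (cos (complex.Im lam * t) -i* sin (complex.Im lam * t)).

Lemma normr_e_ lam t : `|e_ lam t| = (expR (- (complex.Re lam * t)))%:C.
Proof.
rewrite /e_ normrM !normc_def/= expr0n/= addr0 sqrtr_sqr ger0_norm ?expR_ge0//.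
by rewrite sqrrN cos2Dsin2 sqrtr1 mulr1.
Qed.

Context {H : hilbertType R}.

(* So the default value of [toL2] plays no role in [laplace] below. *)
Lemma square_integrable_e_tensor lam (h : H) : 0 < complex.Re lam ->
  square_integrable Rplus_measure (fun t => e_ lam t *: h).
Proof.
move=> l0; split.
  have mexp : measurable_fun setT (fun t : R => expR (- (complex.Re lam * t))).
    by apply: measurableT_comp => //; apply: measurableT_comp => //;
      exact: measurable_funM.
  have marg : measurable_fun setT (fun t : R => complex.Im lam * t).
    exact: measurable_funM.
  have mcos : measurable_fun setT (fun t : R => expR (- (complex.Re lam * t)) *
      cos (complex.Im lam * t)).
    apply: measurable_funM => //; apply: (measurableT_comp _ marg).
    exact: continuous_measurable_fun (@continuous_cos R).
  have msin : measurable_fun setT (fun t : R => expR (- (complex.Re lam * t)) *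
      - sin (complex.Im lam * t)).
    apply: measurable_funM => //; apply: measurableT_comp => //.
    apply: (measurableT_comp _ marg).
    exact: continuous_measurable_fun (@continuous_sin R).
  have := strongly_measurable_lin 'i (strongly_measurable_scale h msin)
    (strongly_measurable_scale h mcos).
  congr strongly_measurable; apply/funext => t /=.
  rewrite scalerA -scalerDl; congr (_ *: _).
  by rewrite /e_; congr (_ +i* _) => /=; ring.
set c := complex.Re lam in l0 *.
have r0 : 0 < 2 * c by rewrite mulr_gt0.
have mf : measurable_fun setT (fun t : R => (expR (- (c * t)) * rnorm h) ^+ 2).
  apply: measurable_funX; apply: measurable_funM => //.
  by apply: measurableT_comp => //; apply: measurableT_comp => //;
    exact: measurable_funM.
under eq_integral do rewrite rnormZ normr_e_ -/c /=.
rewrite ge0_integral_Rplus; last 2 first.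
  exact/measurable_EFinP.
  by move=> t; rewrite lee_fin sqr_ge0.
have Ie := integrableZl measurableT ((2 * c)^-1 * rnorm h ^+ 2)
  (integrable_exponential_pdf r0).
pose D : set (measurableTypeR R) := `[0%R, +oo[%classic.
have mD : measurable D by exact: measurable_itv.
have := integrableS measurableT mD (@subsetT _ _) Ie.
move=> /integrableP[_]; apply: le_lt_trans.
rewrite le_eqVlt; apply/orP; left; apply/eqP; apply: eq_integral => t.
rewrite inE/= in_itv/= andbT => t0; rewrite exponential_pdfE//.
rewrite ger0_norm ?mulr_ge0 ?invr_ge0 ?expR_ge0 ?sqr_ge0 ?(ltW r0) ?(ltW l0) ?rnorm_ge0//; congr EFin.
have -> : - (2 * c) * t = - (c * t) + - (c * t) by ring.
by rewrite expRD; field; rewrite lt0r_neq0.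
Qed.

(* Meaningful for [0 < Re lam] only. *)
Definition laplace (E : Type) (Phi : L2Rplus H -> E) (lam : R[i]) (h : H) : E :=
  Phi (toL2 Rplus_measure (fun t => e_ lam t *: h)).

Definition laplace_family (E : Type) (Phi : L2Rplus H -> E) (b : R) : set (H -> E) :=
  [set laplace Phi lam | lam in [set lam | b <= complex.Re lam]].

End Laplace_transform.

Section Hilbert_space_notions.
Context {R : realType}.

Definition inorm {K : innerProductType R} (x : K) : R :=
  Num.sqrt (complex.Re (inner x x)).

(* Only bases indexed by nat are needed: the spaces H and L^2(R_+; H) are
   separable and infinite-dimensional. *)
Definition orthonormal_basis {K : innerProductType R} (k : nat -> K) :=
  (forall i j, inner (k i) (k j) = (i == j)%:R :> R[i]) /\
  (forall x (eps : R), 0 < eps -> exists n (c : 'I_n -> R[i]),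
     inorm (x - \sum_(i < n) c i *: k i) < eps).

Definition separable_space (V : topologicalType) :=
  exists2 D : set V, countable D & dense D.

Definition infinite_dimensional (V : lmodType R[i]) :=
  forall n (v : 'I_n -> V), exists x, forall c : 'I_n -> R[i],
    x <> \sum_(i < n) c i *: v i.

Definition bounded_linear {K : innerProductType R} {E : normedModType R[i]}
    (T : K -> E) :=
  linear T /\ exists M : R, forall x, rnorm (T x) <= M * inorm x.

End Hilbert_space_notions.

Section gamma_radonifying_operators.
Context dO (Om : measurableType dO) (R : realType) (P : probability Om R).
Variable g : nat -> {RV P >-> R}.

Definition mutually_independent :=
  forall (J : seq nat) (B : nat -> set R), uniq J ->
    (forall i, measurable (B i)) ->
    P (\bigcap_(i in [set` J]) (g i @^-1` B i)) =
    (\prod_(i <- J) P (g i @^-1` B i))%E.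

Definition gaussian_sequence :=
  (forall k (A : set R), measurable A ->
     distribution P (g k) A = normal_prob 0 1 A) /\
  mutually_independent.

Context {E : completeNormedModType R[i]}.

Definition second_moment (X : Om -> E) : \bar R :=
  'E_P[fun w => rnorm (X w) ^+ 2].

Definition gamma_psum (x : nat -> E) (n : nat) (w : Om) : E :=
  \sum_(k < n) (g k w)%:C *: x k.

(* [\sum_k g k *: x k] converges to [X] in L^2(Om; E). *)
Definition gamma_cvg (x : nat -> E) (X : Om -> E) :=
  [/\ strongly_measurable X, (second_moment X < +oo)%E &
      second_moment (fun w => gamma_psum x n w - X w)
        @[n --> \oo] --> 0%E].

Definition gamma_converges (x : nat -> E) := exists X, gamma_cvg x X.

(* The sum of the series, unique up to almost sure equality. *)
Definition gamma_sum (x : nat -> E) : Om -> E :=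
  xget (fun=> 0) (gamma_cvg x).

(* Membership in gamma(K, E). Boundedness is required explicitly: convergence
   along one basis does not control an unbounded operator off its span. *)
Definition gamma_radonifying {K : innerProductType R} (T : K -> E) :=
  bounded_linear T /\
  exists2 k : nat -> K, orthonormal_basis k & gamma_converges (T \o k).

(* The norm of gamma(K, E), computed in the orthonormal basis [k]. The basis is
   kept explicit because, with real Gaussians and complex scalars, its value
   depends on [k] (though only up to a universal factor). *)
Definition gamma_norm {K : innerProductType R} (k : nat -> K) (T : K -> E) : \bar R :=
  sqrte (second_moment (gamma_sum (T \o k))).

Definition unif_gamma_radonifying {H : innerProductType R} (F : set (H -> E)) :=
  (forall T, F T -> bounded_linear T) /\
  forall (h : nat -> H) (T : nat -> H -> E),
    orthonormal_basis h -> (forall k, F (T k)) ->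
    gamma_converges (fun k => T k (h k)).

Definition unif_gamma_norm {H : innerProductType R} (F : set (H -> E)) : \bar R :=
  sqrte (ereal_sup [set s | exists (h : nat -> H) (T : nat -> H -> E),
    [/\ orthonormal_basis h, forall k, F (T k) &
        s = second_moment (gamma_sum (fun k => T k (h k)))]]).

End gamma_radonifying_operators.

(* Main.v *)
Require Import Defs.
From HB Require Import structures.
From mathcomp Require Import all_boot all_order all_algebra ring lra.
From mathcomp Require Import complex.
From mathcomp Require Import all_classical all_reals all_analysis.
From mathcomp Require Import measurable_realfun.

Set Implicit Arguments.
Unset Strict Implicit.
Unset Printing Implicit Defensive.

Import Order.TTheory GRing.Theory Num.Theory.
Import numFieldNormedType.Exports.

Local Open Scope classical_set_scope.
Local Open Scope ring_scope.
Local Open Scope complex_scope.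

(** Along an orthonormal basis [h] of [H] and for any choice of operators
    [T k = laplace Phi (lam k)] with [Re (lam k) >= b], the vector [T k (h k)] is
    the value of [Phi] at the exponential tensor [f k = e_(lam k) (x) h k]. These
    tensors are pairwise orthogonal in [L^2(R_+; H)], because the [h k] are, and
    their squared norms are [1 / (2 Re (lam k)) <= 1 / (2 b)]. The theorem is
    therefore the ideal property of gamma-radonifying operators for the operator
    of norm at most [1 / sqrt (2 b)] that sends an orthonormal basis to [f]. This
    is [gamma_ideal], which gives both the convergence and the bound. Applied to
    orthonormal families, it also shows that radonification does not depend on
    the basis up to a constant.

    The ideal property rests on a contraction principle
    ([gauss_moment_contraction]): if [x_n = \sum_j a_nj y_j] with a real
    contraction matrix [a], then [E |\sum_n gamma_n x_n|^2] is at most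
    [E |\sum_j gamma_j y_j|^2]. Its proof is elementary. Second moments are
    written as iterated integrals against the normal law
    ([second_moment_gamma_psum]). They are invariant under plane rotations of two
    neighbouring vectors ([gauss_moment_rot]) and grow when vectors are added
    ([gauss_moment_mono]). Rotations bring any contraction matrix row by row into
    a form where the claim amounts to omitting vectors.

    Bessel's inequality says that the coefficients of an orthogonal family in an
    orthonormal basis form such a contraction, up to scaling. This bounds the
    partial sums of [\sum_n gamma_n Phi (f n)] and, after splitting the
    expansions at a large index, shows that they are Cauchy
    ([gamma_psum_ideal_cauchy]). Completeness of the space of square integrable
    random vectors ([second_moment_complete]) provides the sum. As only some
    universal constant is claimed, triangle inequalities are used in the form
    [|x + y|^2 <= 2 |x|^2 + 2 |y|^2], and complex coefficients are split into
    real and imaginary parts. *)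

(** * Rotation invariance of the Gaussian measure of the plane *)

Section gauss_plane.
Context {R : realType}.
Local Notation leb := (@lebesgue_measure R).
Local Notation nu := (normal_prob (0 : R) 1).
Local Open Scope ereal_scope.

(** The density of the normal law agrees almost everywhere with its
    Radon-Nikodym derivative, for which the change of variables is known. *)
Lemma ge0_integral_normal_prob (f : R -> \bar R) :
  measurable_fun setT f -> (forall x, 0 <= f x) ->
  \int[nu]_x f x = \int[leb]_x (f x * (normal_pdf 0 1 x)%:E).
Proof.
move=> mf f0; have dom := normal_prob_dominates (0 : R) 1.
rewrite -(Radon_Nikodym_SigmaFinite.change_of_variables dom)//.
set g := Radon_Nikodym_SigmaFinite.f _ _.
have mg : measurable_fun setT g.
  exact: measurable_int (Radon_Nikodym_SigmaFinite.f_integrable dom).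
have mp : measurable_fun setT (fun x : R => (normal_pdf 0 1 x)%:E).
  by apply/measurable_EFinP; exact: measurable_normal_pdf.
apply: ge0_ae_eq_integral => //.
- exact: emeasurable_funM.
- exact: emeasurable_funM.
- by move=> x _; rewrite mule_ge0// Radon_Nikodym_SigmaFinite.f_ge0.
- by move=> x _; rewrite mule_ge0// lee_fin normal_pdf_ge0.
apply: ae_eqe_mul2l; apply: integral_ae_eq => //.
- exact: Radon_Nikodym_SigmaFinite.f_integrable.
- move=> A _ mA; rewrite -Radon_Nikodym_SigmaFinite.f_integral//.
Qed.

Lemma lebesgue_measure_shift (a : R) (A : set R) : measurable A ->
  pushforward leb ((fun x => x + a)%R : _ -> measurableTypeR R) A = leb A.
Proof.
have ma : measurable_fun setT ((fun x => x + a)%R : measurableTypeR R -> measurableTypeR R).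
  exact: measurable_funD.
pose phi : {mfun measurableTypeR R >-> measurableTypeR R} :=
  HB.pack (fun x : R => x + a)%R (isMeasurableFun.Build _ _ _ _ _ ma).
move=> mA; apply/esym; rewrite -[RHS]/(pushforward leb phi A).
apply: lebesgue_measure_unique => //= _ [[x y]] _ <-.
rewrite /pushforward/=.
rewrite (_ : _ @^-1` _ = `](x - a)%R, (y - a)%R]%classic); last first.
  by apply/seteqP; split => t /=; rewrite !in_itv/= ltrBlDr lerBrDr.
rewrite !lebesgue_measure_itv/= !lte_fin ltrD2r.
by case: ifP => // _; rewrite -!EFinB; congr EFin; ring.
Qed.

Lemma ge0_integral_shift (a : R) (f : R -> \bar R) :
  measurable_fun setT f -> (forall x, 0 <= f x) ->
  \int[leb]_x f (x + a)%R = \int[leb]_x f x.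
Proof.
move=> mf f0.
have ma : measurable_fun setT ((fun x => x + a)%R : measurableTypeR R -> measurableTypeR R).
  exact: measurable_funD.
rewrite -(@ge0_integral_pushforward _ _ _ _ _ _ ma leb setT f)//=.
by apply: eq_measure_integral => A mA _; exact: lebesgue_measure_shift.
Qed.

Definition plane_integral (g : R * R -> \bar R) :=
  \int[leb]_x \int[leb]_y g (x, y).

Lemma measurable_lin2 (a b : R) :
  measurable_fun setT (fun p : R * R => a * p.1 + b * p.2)%R.
Proof. by apply: measurable_funD; apply: measurable_funM. Qed.

Lemma plane_integral_shear2 (g : R * R -> \bar R) (a : R) :
  measurable_fun setT g -> (forall p, 0 <= g p) ->
  plane_integral (fun p => g (p.1, p.2 + a * p.1)%R) = plane_integral g.
Proof.
move=> mg g0; apply: eq_integral => x _ /=.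
apply: (@ge0_integral_shift (a * x) (fun y => g (x, y))) => [|y]; last exact: g0.
exact: (measurableT_comp mg).
Qed.

Lemma measurable_shear1 (g : R * R -> \bar R) (a : R) : measurable_fun setT g ->
  measurable_fun setT (fun p : R * R => g (p.1 + a * p.2, p.2)%R).
Proof.
move=> mg; apply: (measurableT_comp mg); apply: measurable_fun_pair => //.
by have := measurable_lin2 1 a; under eq_fun do rewrite mul1r.
Qed.

Lemma measurable_shear2 (g : R * R -> \bar R) (a : R) : measurable_fun setT g ->
  measurable_fun setT (fun p : R * R => g (p.1, p.2 + a * p.1)%R).
Proof.
move=> mg; apply: (measurableT_comp mg); apply: measurable_fun_pair => //.
by have := measurable_lin2 a 1; under eq_fun do rewrite mul1r addrC.
Qed.

Lemma plane_integral_shear1 (g : R * R -> \bar R) (a : R) :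
  measurable_fun setT g -> (forall p, 0 <= g p) ->
  plane_integral (fun p => g (p.1 + a * p.2, p.2)%R) = plane_integral g.
Proof.
move=> mg g0; rewrite /plane_integral.
rewrite (fubini_tonelli (m1 := leb) (m2 := leb) g mg g0).
rewrite (fubini_tonelli (m1 := leb) (m2 := leb) _ (measurable_shear1 a mg)); last first.
  by move=> p; exact: g0.
apply: eq_integral => y _ /=.
apply: (@ge0_integral_shift (a * y) (fun x => g (x, y))) => [|x]; last exact: g0.
exact: (measurableT_comp mg).
Qed.

(** A rotation with [s != 0] is a product of three shears, each of which
    preserves the iterated Lebesgue integral because, on every line, it acts as
    a translation. Identity and half-turn are not covered, hence [s != 0]. *)
Lemma plane_integral_rot (g : R * R -> \bar R) (c s : R) :
  measurable_fun setT g -> (forall p, 0 <= g p) ->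
  s != 0%R -> (c ^+ 2 + s ^+ 2 = 1)%R ->
  plane_integral (fun p => g (c * p.1 + s * p.2, - s * p.1 + c * p.2)%R) =
  plane_integral g.
Proof.
move=> mg g0 s0 cs; set a := ((1 - c) / s)%R.
have mg1 := measurable_shear1 a mg.
have mg2 := measurable_shear2 (- s) mg1.
rewrite -[RHS](plane_integral_shear1 a mg g0).
rewrite -[RHS](plane_integral_shear2 (- s) mg1 (fun p => g0 _)).
rewrite -[RHS](plane_integral_shear1 a mg2 (fun p => g0 _)).
congr plane_integral; apply/funext => -[x y] /=; congr g; congr pair.
  have -> : (s * y = (1 - c ^+ 2) / s * y)%R by rewrite -cs; field.
  by rewrite /a; field.
by rewrite /a; field.
Qed.

Lemma normal_pdf_rot (c s x y : R) : (c ^+ 2 + s ^+ 2 = 1)%R ->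
  (normal_pdf 0 1 (c * x + s * y) * normal_pdf 0 1 (- s * x + c * y) =
   normal_pdf 0 1 x * normal_pdf 0 1 y)%R.
Proof.
move=> cs; rewrite !normal_pdfE ?oner_eq0// /normal_fun.
rewrite mulrACA [RHS]mulrACA; congr (_ * _)%R; rewrite -!expRD; congr expR.
rewrite !subr0 -!mulNr -!mulrDl; congr (_ / _)%R.
transitivity (- (c ^+ 2 + s ^+ 2) * (x ^+ 2 + y ^+ 2))%R; first by ring.
by rewrite cs; ring.
Qed.

Lemma gauss2_planeE (F : R * R -> \bar R) :
  measurable_fun setT F -> (forall p, 0 <= F p) ->
  \int[nu]_x \int[nu]_y F (x, y) =
  plane_integral (fun p => F p * (normal_pdf 0 1 p.1 * normal_pdf 0 1 p.2)%:E).
Proof.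
move=> mF F0.
have mp : measurable_fun setT (fun x : R => (normal_pdf 0 1 x)%:E).
  by apply/measurable_EFinP; exact: measurable_normal_pdf.
have p0 x : (0 <= (normal_pdf (0:R) 1 x)%:E)%E by rewrite lee_fin normal_pdf_ge0.
rewrite ge0_integral_normal_prob; last 2 first.
- exact: (measurable_fun_fubini_tonelli_F (m2 := nu)).
- by move=> x; apply: integral_ge0.
apply: eq_integral => x _; rewrite /= ge0_integral_normal_prob//; last exact: measurableT_comp.
rewrite -ge0_integralZr//; last 2 first.
  by apply: emeasurable_funM => //; exact: measurableT_comp.
  by move=> y _; rewrite mule_ge0.
by apply: eq_integral => y _; rewrite -muleA -EFinM mulrC.
Qed.

(** The density of the Gaussian measure of the plane only depends on the
    distance to the origin, so it inherits the invariance of Lebesgue measure. *)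
Lemma gauss2_rot (F : R * R -> \bar R) (c s : R) :
  measurable_fun setT F -> (forall p, 0 <= F p) ->
  s != 0%R -> (c ^+ 2 + s ^+ 2 = 1)%R ->
  \int[nu]_x \int[nu]_y F (c * x + s * y, - s * x + c * y)%R =
  \int[nu]_x \int[nu]_y F (x, y).
Proof.
move=> mF F0 s0 cs.
have mp : measurable_fun setT (normal_pdf (0:R) 1) by exact: measurable_normal_pdf.
have mrot : measurable_fun setT (fun p => F (c * p.1 + s * p.2, - s * p.1 + c * p.2)%R).
  by apply: (measurableT_comp mF); apply: measurable_fun_pair; exact: measurable_lin2.
have mpF : measurable_fun setT
    (fun p : R * R => F p * (normal_pdf 0 1 p.1 * normal_pdf 0 1 p.2)%:E).
  apply: emeasurable_funM => //; apply/measurable_EFinP.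
  by apply: measurable_funM; apply: measurableT_comp.
have pF0 (p : R * R) : 0 <= F p * (normal_pdf 0 1 p.1 * normal_pdf 0 1 p.2)%:E.
  by rewrite mule_ge0// lee_fin mulr_ge0// normal_pdf_ge0.
rewrite (gauss2_planeE mrot (fun p => F0 _)) (gauss2_planeE mF F0).
rewrite -(plane_integral_rot mpF pF0 s0 cs).
by congr plane_integral; apply/funext => -[x y] /=; rewrite normal_pdf_rot.
Qed.

Lemma gauss_sym (f : R -> \bar R) : measurable_fun setT f -> (forall x, 0 <= f x) ->
  \int[nu]_x f (- x)%R = \int[nu]_x f x.
Proof.
move=> mf f0; rewrite !ge0_integral_normal_prob//; last exact: measurableT_comp.
have mN : measurable_fun setT (-%R : measurableTypeR R -> measurableTypeR R) by [].
pose h x := f x * (normal_pdf 0 1 x)%:E.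
have mh : measurable_fun setT h.
  by apply: emeasurable_funM => //; apply/measurable_EFinP; exact: measurable_normal_pdf.
rewrite (_ : \int[leb]_x _ = \int[leb]_x h (- x)%R); last first.
  apply: eq_integral => x _; rewrite /h !normal_pdfE ?oner_eq0// /normal_fun.
  by rewrite !subr0 sqrrN.
have -> : \int[leb]_x h (- x)%R = \int[pushforward leb (-%R : _ -> measurableTypeR R)]_x h x.
  rewrite (@ge0_integral_pushforward _ _ _ _ _ _ mN leb setT h)//=.
  by move=> x _; rewrite /h mule_ge0// lee_fin normal_pdf_ge0.
by apply: eq_measure_integral => A mA _; exact: lebesgue_measureN.
Qed.

End gauss_plane.

(** * Second moments of Gaussian sums as iterated integrals *)

Section strongly_measurable_comp.
Context d d' (T : measurableType d) (Z : measurableType d') (R : realType).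
Context {E : normedModType R[i]}.

Lemma strongly_measurable_comp (f : T -> E) (phi : Z -> T) :
  strongly_measurable f -> measurable_fun setT phi ->
  strongly_measurable (f \o phi).
Proof.
move=> [s ss sf] mphi; exists (fun n => s n \o phi) => [n|z]; last exact: sf.
have [fs ms] := ss n; split => [|v].
  by apply: sub_finite_set fs => _ [z _ <-]; exists (phi z).
by rewrite comp_preimage -[X in measurable X]setTI; exact: mphi.
Qed.

Lemma strongly_measurableD (f h : T -> E) :
  strongly_measurable f -> strongly_measurable h ->
  strongly_measurable (fun x => f x + h x).
Proof.
move=> mf mh; have := strongly_measurable_lin 1 mf mh.
by congr strongly_measurable; apply/funext => x; rewrite scale1r.
Qed.

Lemma strongly_measurableB (f h : T -> E) :
  strongly_measurable f -> strongly_measurable h ->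
  strongly_measurable (fun x => f x - h x).
Proof.
move=> mf mh; have := strongly_measurable_lin (-1) mh mf.
by congr strongly_measurable; apply/funext => x; rewrite scaleN1r addrC.
Qed.

Lemma strongly_measurable_sum (I : Type) (r : seq I) (f : I -> T -> E) :
  (forall i, strongly_measurable (f i)) ->
  strongly_measurable (fun x => \sum_(i <- r) f i x).
Proof.
move=> mf; elim: r => [|i r ih].
  by under eq_fun do rewrite big_nil; exact: strongly_measurable_cst.
by under eq_fun do rewrite big_cons; exact: strongly_measurableD.
Qed.

End strongly_measurable_comp.

Section gaussian_moment.
Context {R : realType} {E : normedModType R[i]}.
Local Notation nu := (normal_prob (0 : R) 1).
Implicit Types (x y e : E) (s l : seq E).
Local Open Scope ereal_scope.

Lemma gauss_integralD (f h : R -> \bar R) :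
  measurable_fun setT f -> measurable_fun setT h ->
  (forall t, 0 <= f t) -> (forall t, 0 <= h t) ->
  \int[nu]_t (f t + h t) = \int[nu]_t f t + \int[nu]_t h t.
Proof. by move=> mf mh f0 h0; exact: ge0_integralD. Qed.

(** For independent standard Gaussian variables this is the second moment of
    [e + \sum_i gamma_i s_i], written as an iterated integral so that operations
    on one or two neighbouring vectors only involve one or two integrals. *)
Fixpoint gauss_moment s e : \bar R :=
  if s is x :: s' then \int[nu]_t gauss_moment s' (e + t%:C *: x)%R
  else (rnorm e ^+ 2)%:E.

Lemma gauss_moment_ge0 s e : 0 <= gauss_moment s e.
Proof.
by elim: s e => [|x s ih] e /=; [rewrite lee_fin sqr_ge0|exact: integral_ge0].
Qed.

Lemma measurable_gauss_moment s d (Z : measurableType d) (e : Z -> E) :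
  strongly_measurable e -> measurable_fun setT (fun z => gauss_moment s (e z)).
Proof.
elim: s d Z e => [|x s ih] d Z e me /=.
  by apply/measurable_EFinP/measurable_funX; exact: measurable_rnorm.
pose F (p : Z * R) := gauss_moment s (e p.1 + p.2%:C *: x)%R.
apply: (measurable_fun_fubini_tonelli_F (m2 := nu) F) => [|p]; last exact: gauss_moment_ge0.
apply: ih; apply: strongly_measurableD.
  by apply: (strongly_measurable_comp me); exact: measurable_fst.
by apply: strongly_measurable_scale; exact: measurable_snd.
Qed.

Lemma strongly_measurable_affine d (Z : measurableType d) (f : Z -> R) e x :
  measurable_fun setT f -> strongly_measurable (fun z => e + (f z)%:C *: x)%R.
Proof.
move=> mf; apply: strongly_measurableD; first exact: strongly_measurable_cst.
exact: strongly_measurable_scale.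
Qed.

Lemma measurable_gauss_moment_line s e x :
  measurable_fun setT (fun t : R => gauss_moment s (e + t%:C *: x)%R).
Proof. by apply: measurable_gauss_moment; apply: strongly_measurable_affine. Qed.

Lemma gauss_moment0 s e : gauss_moment (0%R :: s) e = gauss_moment s e.
Proof.
rewrite /= (eq_integral (fun=> gauss_moment s e)); last first.
  by move=> t _; rewrite scaler0 addr0.
rewrite integral_cst//; by rewrite [X in _ * X]probability_setT mule1.
Qed.

Lemma gauss_momentN s x e : gauss_moment (- x :: s)%R e = gauss_moment (x :: s) e.
Proof.
rewrite /= -(gauss_sym (measurable_gauss_moment_line s e x)); last first.
  by move=> t; exact: gauss_moment_ge0.
by apply: eq_integral => t _; rewrite scalerN rmorphN scaleNr.
Qed.

Lemma le_gauss_moment s s' x e : (forall e, gauss_moment s e <= gauss_moment s' e) ->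
  gauss_moment (x :: s) e <= gauss_moment (x :: s') e.
Proof.
move=> ss'; apply: ge0_le_integral => //.
- by move=> t _; exact: gauss_moment_ge0.
- exact: measurable_gauss_moment_line.
- exact: measurable_gauss_moment_line.
Qed.

(** Midpoint convexity, inherited from the squared norm. *)
Lemma gauss_moment_midpoint s e x :
  gauss_moment s e + gauss_moment s e <=
  gauss_moment s (e + x)%R + gauss_moment s (e - x)%R.
Proof.
elim: s e => [|y s ih] e /=.
  rewrite -!EFinD lee_fin.
  have := rnormD (e + x)%R (e - x)%R; rewrite addrACA subrr addr0.
  have -> : (e + e = (2%:R : R[i]) *: e)%R by rewrite scaler_nat mulr2n.
  rewrite rnormZ normr_nat -[2%:R]/((1 + 1)%R) /=.
  have := rnorm_ge0 (e + x)%R; have := rnorm_ge0 (e - x)%R; have := rnorm_ge0 e.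
  set a := rnorm e; set b := rnorm _; set c := rnorm _ => a0 b0 c0 h.
  have := sqr_ge0 (b - c); nra.
have mg v := measurable_gauss_moment_line s v y.
have g0 v t : 0 <= gauss_moment s (v + t%:C *: y)%R by exact: gauss_moment_ge0.
rewrite -(gauss_integralD (mg _) (mg _) (g0 _) (g0 _)).
rewrite -(gauss_integralD (mg _) (mg _) (g0 _) (g0 _)).
apply: ge0_le_integral => //.
- by move=> t _; exact: adde_ge0.
- exact: (emeasurable_funD (mg _) (mg _)).
- exact: (emeasurable_funD (mg _) (mg _)).
- by move=> t _; rewrite (addrAC e x) (addrAC e (- x)%R); exact: ih.
Qed.

(** A further independent symmetric summand can only increase the second moment:
    average the midpoint inequality over the symmetric law of the new variable. *)
Lemma gauss_moment_mono s x e : gauss_moment s e <= gauss_moment (x :: s) e.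
Proof.
have mx := measurable_gauss_moment_line s e x.
have mNx := measurable_gauss_moment_line s e (- x)%R.
have g0 v (t : R) : 0 <= gauss_moment s (e + t%:C *: v)%R by exact: gauss_moment_ge0.
have h : gauss_moment s e + gauss_moment s e <=
    gauss_moment (x :: s) e + gauss_moment (x :: s) e.
  rewrite -{2}gauss_momentN /= -(gauss_integralD mx mNx (g0 _) (g0 _)).
  rewrite (_ : gauss_moment s e + _ = \int[nu]_t (gauss_moment s e + gauss_moment s e)); last first.
    by rewrite integral_cst// [X in _ * X]probability_setT mule1.
  apply: ge0_le_integral => //.
  - by move=> t _; rewrite adde_ge0// gauss_moment_ge0.
  - exact: (emeasurable_funD mx mNx).
  - by move=> t _; rewrite scalerN; exact: gauss_moment_midpoint.
move: h; rewrite -!mule2n -!mule_natl lee_pmul2l//.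
Qed.

Lemma gauss_moment_nil_le s e : gauss_moment [::] e <= gauss_moment s e.
Proof. by elim: s => // x s ih; exact: le_trans ih (gauss_moment_mono _ _ _). Qed.

(** The vectors [x], [y] may be replaced by their images under a plane rotation
    without changing the law of the Gaussian sum. *)
Lemma gauss_moment_rot (c s : R) x y l e :
  s != 0%R -> (c ^+ 2 + s ^+ 2 = 1)%R ->
  gauss_moment [:: c%:C *: x + s%:C *: y, (- s)%:C *: x + c%:C *: y & l]%R e =
  gauss_moment [:: x, y & l] e.
Proof.
move=> s0 cs.
pose F (p : R * R) := gauss_moment l (e + p.1%:C *: x + p.2%:C *: y)%R.
have mF : measurable_fun setT F.
  apply: measurable_gauss_moment; apply: strongly_measurableD.
    by apply: strongly_measurable_affine; exact: measurable_fst.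
  by apply: strongly_measurable_scale; exact: measurable_snd.
have F0 p : 0 <= F p by exact: gauss_moment_ge0.
have Ns0 : (- s != 0)%R by rewrite oppr_eq0.
have cNs : (c ^+ 2 + (- s) ^+ 2 = 1)%R by rewrite sqrrN.
refine (etrans _ (gauss2_rot mF F0 Ns0 cNs)).
apply: eq_integral => t _; apply: eq_integral => u _; rewrite /F /= opprK.
congr gauss_moment; rewrite -!addrA; congr (_ + _)%R.
rewrite !scalerDr !scalerA -!rmorphM/= addrACA -!scalerDl -!rmorphD/=.
by congr (_%:C *: _ + _%:C *: _)%R; ring.
Qed.

End gaussian_moment.

(** * Contraction principle for Gaussian sums *)

Section contraction.
Context {R : realType} {E : normedModType R[i]}.
Implicit Types (u v : seq (E * (nat -> R))) (e : E).

(** A pair [(y, a)] stands for a vector [y] together with its coefficients in a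
    family [x_n = \sum a n y]: carrying the columns of the coefficient matrix
    along with the vectors makes each rotation act on both at once. *)
Definition combination u (n : nat) : E := \sum_(q <- u) (q.2 n)%:C *: q.1.

Definition column_sqnorm (N : nat) (c : nat -> R) u : R :=
  \sum_(q <- u) (\sum_(n < N) c n * q.2 n) ^+ 2.

Definition rotate (c s : R) (p q : E * (nat -> R)) : E * (nat -> R) :=
  (c%:C *: p.1 + s%:C *: q.1, fun n => c * p.2 n + s * q.2 n).

Lemma combination_rotate (c s : R) p q u n : c ^+ 2 + s ^+ 2 = 1 ->
  combination [:: rotate c s p q, rotate (- s) c p q & u] n =
  combination [:: p, q & u] n.
Proof.
move=> cs; rewrite /combination !big_cons !addrA; congr (_ + _) => /=.
rewrite !scalerDr !scalerA -!rmorphM/= addrACA -!scalerDl -!rmorphD/=.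
congr (_%:C *: _ + _%:C *: _).
  transitivity ((c ^+ 2 + s ^+ 2) * p.2 n); last by rewrite cs mul1r.
  by ring.
transitivity ((c ^+ 2 + s ^+ 2) * q.2 n); last by rewrite cs mul1r.
by ring.
Qed.

Lemma column_sqnorm_rotate N d (c s : R) p q u : c ^+ 2 + s ^+ 2 = 1 ->
  column_sqnorm N d [:: rotate c s p q, rotate (- s) c p q & u] =
  column_sqnorm N d [:: p, q & u].
Proof.
move=> cs; rewrite /column_sqnorm !big_cons !addrA; congr (_ + _) => /=.
have lin (a b : R) : \sum_(n < N) d n * (a * p.2 n + b * q.2 n) =
    a * (\sum_(n < N) d n * p.2 n) + b * (\sum_(n < N) d n * q.2 n).
  by rewrite !mulr_sumr -big_split/=; apply: eq_bigr => n _; ring.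
rewrite !lin; set A := \sum_(n < N) _; set B := \sum_(n < N) _.
transitivity ((c ^+ 2 + s ^+ 2) * (A ^+ 2 + B ^+ 2)); last by rewrite cs mul1r.
by ring.
Qed.

(** Givens elimination of the first row of the coefficient matrix: plane
    rotations concentrate it in a single column. They change neither the
    Gaussian sum nor the family [combination u], and they preserve the Euclidean
    norm of every linear combination of the rows. *)
Lemma eliminate_first_row u : exists p v,
  [/\ forall q, q \in v -> q.2 0%N = 0,
      forall e, gauss_moment (map fst (p :: v)) e = gauss_moment (map fst u) e,
      forall n, combination (p :: v) n = combination u n &
      forall N c, column_sqnorm N c (p :: v) = column_sqnorm N c u].
Proof.
elim: u => [|q u [p [v [v0 mv cv sv]]]].
  exists (0, fun=> 0), [::]; split=> //= [e|n|N c].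
  - exact: (gauss_moment0 [::]).
  - by rewrite /combination big_cons scaler0 add0r.
  - rewrite /column_sqnorm big_cons big1 ?expr0n ?add0r// => n _.
    by rewrite mulr0.
have mqu e : gauss_moment (map fst [:: q, p & v]) e = gauss_moment (map fst (q :: u)) e.
  by apply: eq_integral => t _; exact: mv.
have cqu n : combination [:: q, p & v] n = combination (q :: u) n.
  by rewrite /combination big_cons -/(combination (p :: v) n) cv big_cons.
have squ N c : column_sqnorm N c [:: q, p & v] = column_sqnorm N c (q :: u).
  by rewrite /column_sqnorm big_cons -/(column_sqnorm N c (p :: v)) sv big_cons.
have [p0|p0] := eqVneq (p.2 0%N) 0.
  exists q, (p :: v); split=> // q'; rewrite inE => /predU1P[->//|]; exact: v0.
set a := q.2 0%N; set b := p.2 0%N in p0.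
pose r := Num.sqrt (a ^+ 2 + b ^+ 2).
have r2 : r ^+ 2 = a ^+ 2 + b ^+ 2 by rewrite sqr_sqrtr// addr_ge0// sqr_ge0.
have b2 : 0 < b ^+ 2 by rewrite exprn_even_gt0.
have a2 := sqr_ge0 a.
have r0 : r != 0 by rewrite -sqrf_eq0 r2 gt_eqF//; lra.
have cs : (a / r) ^+ 2 + (b / r) ^+ 2 = 1.
  by rewrite !exprMn -mulrDl -r2 exprVn divff// sqrf_eq0.
have s0 : b / r != 0 by rewrite mulf_neq0// invr_eq0.
exists (rotate (a / r) (b / r) q p), (rotate (- (b / r)) (a / r) q p :: v); split.
- move=> q'; rewrite inE => /predU1P[->/=|]; last exact: v0.
  by rewrite -/a -/b; field.
- by move=> e; rewrite -mqu; exact: gauss_moment_rot.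
- by move=> n; rewrite combination_rotate.
- by move=> N c; rewrite column_sqnorm_rotate.
Qed.

Definition shift_columns u : seq (E * (nat -> R)) :=
  [seq (q.1, fun n => q.2 n.+1) | q <- u].

(** If the coefficient matrix is a contraction, the Gaussian sum of the family
    [combination u] is dominated by that of the vectors of [u]. By induction on
    the number of rows. After elimination the first new vector is [al *: y], with
    [|al| <= 1]; a rotation splits [y] into [al *: y] and [sg *: y], where
    [sg = sqrt (1 - al^2)]. The first part is the first new vector, and the
    remaining rows, rescaled by [1 / sg] in the column of [y], form again a
    contraction with respect to the vectors left. *)
Lemma gauss_moment_contraction N u e :
  (forall c, column_sqnorm N c u <= \sum_(n < N) c n ^+ 2) ->
  (gauss_moment [seq combination u n | n <- iota 0 N] e <=
   gauss_moment (map fst u) e)%E.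
Proof.
elim: N u e => [|N ih] u e hu; first exact: gauss_moment_nil_le.
have [p [v [v0 mv cv sv]]] := eliminate_first_row u.
rewrite -mv (_ : map _ _ = [seq combination (p :: v) n | n <- iota 0 N.+1]); last first.
  by apply: eq_map => n; rewrite cv.
have {}hu c : column_sqnorm N.+1 c (p :: v) <= \sum_(n < N.+1) c n ^+ 2.
  by rewrite sv; exact: hu.
clear u mv cv sv.
set al := p.2 0%N.
pose B (c : nat -> R) := \sum_(n < N) c n * p.2 n.+1.
pose S c := column_sqnorm N c (shift_columns v).
(* the contraction inequality with the first coefficient separated *)
have {}hu c0 c : (c0 * al + B c) ^+ 2 + S c <= c0 ^+ 2 + \sum_(n < N) c n ^+ 2.
  have := hu (fun n => if n is n'.+1 then c n' else c0).
  rewrite /column_sqnorm big_cons !big_ord_recl /= -/al.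
  rewrite /S /column_sqnorm big_map /=.
  rewrite (eq_big_seq (fun q => (\sum_(n < N) c n * q.2 n.+1) ^+ 2))// => q qv.
  by rewrite big_ord_recl/= v0// mulr0 add0r.
have S0 c : 0 <= S c by apply: sumr_ge0 => q _; exact: sqr_ge0.
have al1 : al ^+ 2 <= 1.
  have := hu 1 (fun=> 0); rewrite /B !big1 => [|n _|n _]; rewrite ?mul0r ?expr0n//.
  by have := S0 (fun=> 0); rewrite !addr0 mul1r expr1n; lra.
pose sg := Num.sqrt (1 - al ^+ 2).
have sg2 : sg ^+ 2 = 1 - al ^+ 2 by rewrite sqr_sqrtr// subr_ge0.
(* if [sg = 0] then the first row already has norm 1, and the other rows have
   to vanish in its column; the witness makes the cross term exceed the bound *)
have BV c : sg = 0 -> B c = 0.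
  move=> sg0; apply: contrapT => /eqP B0.
  have := hu (al * ((\sum_(n < N) c n ^+ 2) / B c / 2)) c.
  set C := \sum_(n < N) _; have := S0 c => + h.
  have al2 : al ^+ 2 = 1 by move: sg2; rewrite sg0 expr0n/=; lra.
  have : 0 < B c ^+ 2 by rewrite exprn_even_gt0.
  have e1 : (al * (C / B c / 2) * al + B c) ^+ 2 =
      (al * (C / B c / 2)) ^+ 2 * al ^+ 2 + al ^+ 2 * C + B c ^+ 2 by field.
  by move: h; rewrite e1 al2; lra.
have BE c : B c ^+ 2 / sg ^+ 2 + S c <= \sum_(n < N) c n ^+ 2.
  have [sg0|sg0] := eqVneq sg 0.
    rewrite sg0 expr0n invr0 mulr0 add0r.
    by have := hu 0 c; rewrite mul0r add0r expr0n/= add0r BV// expr0n/= add0r.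
  (* this value of [c0] maximises [(c0 * al + B c) ^+ 2 - c0 ^+ 2] *)
  have := hu (al * B c / sg ^+ 2) c.
  have e1 : (al * B c / sg ^+ 2 * al + B c) ^+ 2 =
      B c ^+ 2 / sg ^+ 2 + (al * B c / sg ^+ 2) ^+ 2.
    transitivity (B c ^+ 2 / sg ^+ 4 * (al ^+ 2 + sg ^+ 2) ^+ 2); first by field.
    transitivity (B c ^+ 2 / sg ^+ 4 * (al ^+ 2 + sg ^+ 2)); last by field.
    by rewrite sg2 subrKC expr1n.
  by rewrite e1; lra.
(* when [sg = 0] the division yields 0, which is then the right coefficient *)
pose w := (sg%:C *: p.1, fun n => p.2 n.+1 / sg) :: shift_columns v.
have hw c : column_sqnorm N c w <= \sum_(n < N) c n ^+ 2.
  apply: le_trans (BE c); rewrite /column_sqnorm big_cons /= lerD2r -exprVn -exprMn.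
  by under eq_bigr do rewrite mulrA; rewrite -mulr_suml.
have cw n : (n < N)%N -> combination w n = combination (p :: v) n.+1.
  move=> nN; rewrite /combination !big_cons big_map/=; congr (_ + _).
  rewrite scalerA -rmorphM/=; have [sg0|sg0] := eqVneq sg 0; last by rewrite mulfVK.
  have := BV (fun m => (m == n)%:R) sg0; rewrite /B (bigD1 (Ordinal nN))//= eqxx mul1r.
  rewrite big1 ?addr0 => [->|m /negbTE mn]; first by rewrite mul0r mul0r.
  by rewrite -val_eqE/= in mn; rewrite mn mul0r.
have c0 : combination (p :: v) 0 = al%:C *: p.1.
  by rewrite /combination big_cons big_seq big1 ?addr0// => q /v0->; rewrite scale0r.
have -> : gauss_moment (map fst (p :: v)) e =
    gauss_moment (al%:C *: p.1 :: map fst w) e.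
  have -> : map fst w = sg%:C *: p.1 :: map fst v by rewrite /= -map_comp.
  have [sg0|sg0] := eqVneq sg 0.
    have /eqP : al ^+ 2 = 1 by move: sg2; rewrite sg0 expr0n/=; lra.
    rewrite sqrf_eq1 sg0 scale0r.
    have e0 t : gauss_moment [:: t, 0 & map fst v] e = gauss_moment (t :: map fst v) e.
      by apply: eq_integral => x _; exact: gauss_moment0.
    by rewrite e0 => /predU1P[->|/eqP->]; rewrite ?scale1r// rmorphN scaleN1r gauss_momentN.
  have := @gauss_moment_rot _ _ al (- sg) p.1 0 (map fst v) e.
  rewrite oppr_eq0 opprK !scaler0 !addr0 sqrrN sg2 subrKC => ->//.
  by apply: eq_integral => x _; exact/esym/gauss_moment0.
rewrite [iota 0 N.+1]/= map_cons c0; apply: le_gauss_moment => e'.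
apply: le_trans (ih w e' hw); rewrite le_eqVlt; apply/orP; left; apply/eqP.
congr gauss_moment; rewrite (iotaDl 1 0) -map_comp; apply/eq_in_map => n.
by rewrite mem_iota/= => nN; rewrite cw.
Qed.

End contraction.

(** * Independence: from random sums to iterated integrals *)

Section independence.
Context dO (Om : measurableType dO) (R : realType) (P : probability Om R).
Variable g : nat -> {RV P >-> R}.
Hypothesis gaussian_g : gaussian_sequence g.
Local Notation nu := (normal_prob (0 : R) 1).
Local Open Scope ereal_scope.

(** This pi-system generates the sigma-algebra of [g 0, ..., g n.-1]. *)
Definition past_cylinder (n : nat) : set (set Om) :=
  [set A | exists2 B : nat -> set R, (forall i, measurable (B i)) &
    A = \bigcap_(i in [set` iota 0 n]) (g i @^-1` B i)].

Local Notation past n := (g_sigma_algebraType (past_cylinder n)).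

Let cap_measurable (J : seq nat) (B : nat -> set R) : (forall i, measurable (B i)) ->
  measurable (\bigcap_(i in [set` J]) (g i @^-1` B i)).
Proof.
move=> mB; apply: fin_bigcap_measurable; first exact: finite_seq.
by move=> i _; rewrite -[X in measurable X]setTI; exact: measurable_funP.
Qed.

Lemma past_cylinder_independent n A B : past_cylinder n A -> measurable B ->
  P (A `&` g n @^-1` B) = P A * nu B.
Proof.
move=> [C mC ->] mB; have [gaussg indg] := gaussian_g.
pose C' i := if i == n then B else C i.
have mC' i : measurable (C' i) by rewrite /C'; case: ifP.
have C'E i : (i \in iota 0 n)%N -> C' i = C i.
  by rewrite mem_iota add0n /C' => /andP[_ ni]; rewrite ltn_eqF.
have -> : \bigcap_(i in [set` iota 0 n]) (g i @^-1` C i) `&` g n @^-1` B =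
    \bigcap_(i in [set` rcons (iota 0 n) n]) (g i @^-1` C' i).
  apply/seteqP; split => [w [h gB] i /=|w h].
    rewrite mem_rcons inE => /predU1P[->|ni]; first by rewrite /C' eqxx.
    by rewrite C'E//; exact: h.
  split=> [i ni|].
    have := h i; rewrite /= mem_rcons inE ni orbT => /(_ isT).
    by rewrite C'E.
  by have := h n; rewrite /= mem_rcons inE eqxx => /(_ isT); rewrite /C' eqxx.
rewrite (indg (rcons (iota 0 n) n) C')//; last first.
  by rewrite rcons_uniq iota_uniq mem_iota add0n ltnn andbF.
rewrite big_rcons/= (indg (iota 0 n) C) ?iota_uniq//; congr (_ * _).
  by apply: eq_big_seq => i ni; rewrite C'E.
by rewrite /C' eqxx -(gaussg n).
Qed.

Lemma past_cylinder_measurable n : past_cylinder n `<=` measurable.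
Proof. by move=> _ [B mB ->]; exact: cap_measurable. Qed.

Lemma past_cylinderT n : past_cylinder n setT.
Proof. by exists (fun=> setT) => //; apply/seteqP; split. Qed.

Lemma past_cylinderI n : setI_closed (past_cylinder n).
Proof.
move=> _ _ [B mB ->] [C mC ->]; exists (fun i => B i `&` C i).
  by move=> i; exact: measurableI.
by rewrite -bigcapI.
Qed.

(** Independence passes from the pi-system to the sigma-algebra because two
    finite measures that agree on a generating pi-system are equal. *)
Lemma past_independent n A B : <<s past_cylinder n >> A -> measurable B ->
  P (A `&` g n @^-1` B) = P A * nu B.
Proof.
move=> sA mB; have mgB : measurable (g n @^-1` B).
  by rewrite -[X in measurable X]setTI; exact: measurable_funP.
have nuB : nu B = (fine (nu B))%:E by rewrite fineK// fin_num_measure.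
have nuB0 : (0 <= fine (nu B))%R by rewrite fine_ge0.
rewrite nuB muleC -[LHS]/(mrestr P mgB A) -[RHS]/(mscale (NngNum nuB0) P A).
apply: (@g_sigma_algebra_measure_unique _ _ _ (past_cylinder n) _ (fun=> setT)) sA => //.
- exact: past_cylinder_measurable.
- by move=> _; exact: past_cylinderT.
- by apply: bigcup_const; exists 0%N.
- exact: past_cylinderI.
- move=> C pC; rewrite [LHS]past_cylinder_independent// muleC.
  by transitivity ((fine (nu B))%:E * P C) => //; rewrite -nuB.
- by move=> _; rewrite [X in X < _]/(P _) (le_lt_trans (probability_le1 _ _))// ?ltry//; exact: measurableI.
Qed.

Lemma past_sub_measurable n (A : set Om) : <<s past_cylinder n >> A -> measurable A.
Proof.
exact: (smallest_sub (@sigma_algebra_measurable _ Om) (@past_cylinder_measurable n)).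
Qed.

Let to_past n : Om -> past n := id.
Let measurable_to_past n : measurable_fun setT (to_past n).
Proof. by move=> _ A mA; rewrite setTI; exact: past_sub_measurable mA. Qed.
HB.instance Definition _ n := isMeasurableFun.Build _ _ _ _ (to_past n) (@measurable_to_past n).

Let past_next n (w : Om) : past n * measurableTypeR R := (to_past n w, g n w).
Let measurable_past_next n : measurable_fun setT (past_next n).
Proof.
apply: measurable_fun_pair; first exact: measurable_to_past.
have mgn : measurable_fun setT (g n) by [].
exact: mgn.
Qed.
HB.instance Definition _ n := isMeasurableFun.Build _ _ _ _ (past_next n) (@measurable_past_next n).

(** Fubini's theorem: the joint law of the past and of [g n] is the product of
    their laws. *)
Lemma integral_past_next n (F : past n * measurableTypeR R -> \bar R) :
  measurable_fun setT F -> (forall p, 0 <= F p) ->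
  \int[P]_w F (w, g n w) = \int[P]_w \int[nu]_t F (w, t).
Proof.
move=> mF F0.
rewrite -[LHS]/(\int[P]_w (F \o past_next n) w) -ge0_integral_distribution//.
rewrite -[RHS]/(\int[P]_w ((fun v => \int[nu]_t F (v, t)) \o to_past n) w).
rewrite -(@ge0_integral_distribution _ _ _ _ _ P (to_past n)); last 2 first.
- exact: (measurable_fun_fubini_tonelli_F (m2 := nu)).
- by move=> v; exact: integral_ge0.
rewrite -(fubini_tonelli1 (m1 := distribution P (to_past n)) (m2 := nu) F mF F0).
apply: eq_measure_integral => A mA _; apply/esym.
refine (@product_measure_unique _ _ _ _ _ (distribution P (to_past n)) nu (distribution P (past_next n)) _ A mA).
by move=> B C mB mC; exact: past_independent.
Qed.

Lemma measurable_past n i : (i < n)%N ->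
  measurable_fun setT (g i : past n -> R).
Proof.
move=> ni _ B mB; rewrite setTI; apply: sub_sigma_algebra.
exists (fun j => if j == i then B else setT) => [j|]; first by case: ifP.
apply/seteqP; split => [w gB j _ /=|w]; first by case: eqP => [->|].
by move=> /(_ i); rewrite /= mem_iota ni eqxx; exact.
Qed.

Context {E : completeNormedModType R[i]}.

Lemma strongly_measurable_gamma_psum (x : nat -> E) n :
  strongly_measurable (gamma_psum g x n).
Proof.
by apply: strongly_measurable_sum => i; exact: strongly_measurable_scale.
Qed.

Lemma integral_gauss_moment_psum s (x : nat -> E) n :
  \int[P]_w gauss_moment s (gamma_psum g x n.+1 w) =
  \int[P]_w gauss_moment (x n :: s) (gamma_psum g x n w).
Proof.
pose S (w : past n) := gamma_psum g x n w.
have mS : strongly_measurable S.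
  apply: strongly_measurable_sum => i; apply: strongly_measurable_scale.
  exact: measurable_past.
pose F (p : past n * measurableTypeR R) := gauss_moment s (S p.1 + p.2%:C *: x n)%R.
have mF : measurable_fun setT F.
  apply: measurable_gauss_moment; apply: strongly_measurableD.
    by apply: (strongly_measurable_comp mS); exact: measurable_fst.
  by apply: strongly_measurable_scale; exact: measurable_snd.
have F0 p : 0 <= F p by exact: gauss_moment_ge0.
rewrite -[RHS]/(\int[P]_w \int[nu]_t F (w, t)) -(integral_past_next mF F0).
by apply: eq_integral => w _; rewrite /F /= /S /gamma_psum big_ord_recr.
Qed.

(** Integrating out the variables one after the other, starting with the last. *)
Lemma second_moment_gamma_psum (x : nat -> E) n :
  second_moment P (gamma_psum g x n) = gauss_moment [seq x i | i <- iota 0 n] 0%R.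
Proof.
suff H s : \int[P]_w gauss_moment s (gamma_psum g x n w) =
    gauss_moment ([seq x i | i <- iota 0 n] ++ s) 0%R.
  by rewrite /second_moment unlock -[LHS]/(\int[P]_w gauss_moment [::] _) H cats0.
elim: n s => [|n ih] s.
  under eq_integral do rewrite /gamma_psum big_ord0.
  by rewrite integral_cst// [X in _ * X]probability_setT mule1.
by rewrite integral_gauss_moment_psum ih -[n.+1]addn1 iotaD map_cat -catA.
Qed.

End independence.

(** * Completeness of the space of square integrable random vectors *)

Section second_moment_theory.
Context dO (Om : measurableType dO) (R : realType) (P : probability Om R).
Context {E : completeNormedModType R[i]}.
Implicit Types X Y : Om -> E.
Local Open Scope ereal_scope.

Lemma second_momentE X : second_moment P X = \int[P]_w (rnorm (X w) ^+ 2)%:E.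
Proof. by rewrite /second_moment unlock. Qed.

Lemma second_moment_ge0 X : 0 <= second_moment P X.
Proof. by apply: expectation_ge0 => w; exact: sqr_ge0. Qed.

Lemma measurable_sqr_rnorm X : strongly_measurable X ->
  measurable_fun setT (fun w => (rnorm (X w) ^+ 2)%:E).
Proof.
by move=> mX; apply/measurable_EFinP/measurable_funX; exact: measurable_rnorm.
Qed.

Lemma second_moment_scale_le X Y (c : R) : (0 <= c)%R ->
  strongly_measurable X -> strongly_measurable Y ->
  (forall w, (rnorm (X w) ^+ 2 <= c * rnorm (Y w) ^+ 2)%R) ->
  second_moment P X <= c%:E * second_moment P Y.
Proof.
move=> c0 mX mY h; rewrite !second_momentE -ge0_integralZl_EFin//.
- apply: ge0_le_integral => //.
  + by move=> w _; rewrite lee_fin sqr_ge0.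
  + exact: measurable_sqr_rnorm.
  + by apply: emeasurable_funM => //; exact: measurable_sqr_rnorm.
  + by move=> w _; rewrite -EFinM lee_fin.
- by move=> w _; rewrite lee_fin sqr_ge0.
- exact: measurable_sqr_rnorm.
Qed.

Lemma second_moment_le X Y :
  strongly_measurable X -> strongly_measurable Y ->
  (forall w, (rnorm (X w) <= rnorm (Y w))%R) ->
  second_moment P X <= second_moment P Y.
Proof.
move=> mX mY h; rewrite -[leRHS]mul1e; apply: second_moment_scale_le => // w.
by rewrite mul1r ler_sqr ?nnegrE ?rnorm_ge0.
Qed.

Lemma second_momentZ X (c : R) : (0 <= c)%R -> strongly_measurable X ->
  second_moment P (fun w => (Num.sqrt c)%:C *: X w) <= c%:E * second_moment P X.
Proof.
move=> c0 mX; apply: second_moment_scale_le => //.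
  have := strongly_measurable_lin (Num.sqrt c)%:C mX (strongly_measurable_cst _ 0%R).
  by congr strongly_measurable; apply/funext => w; rewrite addr0.
move=> w; rewrite rnormZ normc_def /= expr0n/= addr0 sqrtr_sqr ger0_norm ?sqrtr_ge0//.
by rewrite exprMn sqr_sqrtr.
Qed.

(** A substitute for Minkowski's inequality that avoids square roots, at the
    price of a factor 2. *)
Lemma second_momentD X Y : strongly_measurable X -> strongly_measurable Y ->
  second_moment P (fun w => X w + Y w)%R <=
  2%:E * second_moment P X + 2%:E * second_moment P Y.
Proof.
move=> mX mY; rewrite !second_momentE.
have mX2 := measurable_sqr_rnorm mX; have mY2 := measurable_sqr_rnorm mY.
have sq0 (Z : Om -> E) w : 0 <= (rnorm (Z w) ^+ 2)%:E by rewrite lee_fin sqr_ge0.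
rewrite -!ge0_integralZl_EFin// -ge0_integralD//; last 4 first.
- by move=> w _; rewrite mule_ge0.
- exact: measurable_funeM.
- by move=> w _; rewrite mule_ge0.
- exact: measurable_funeM.
apply: ge0_le_integral => //.
- by move=> w _; rewrite lee_fin sqr_ge0.
- exact: (measurable_sqr_rnorm (strongly_measurableD mX mY)).
- by apply: emeasurable_funD; exact: measurable_funeM.
move=> w _; rewrite -!EFinM -EFinD lee_fin.
have := rnormD (X w) (Y w); have := rnorm_ge0 (X w); have := rnorm_ge0 (Y w).
have := rnorm_ge0 (X w + Y w)%R.
set a := rnorm (X w); set b := rnorm (Y w); set c := rnorm _ => c0 b0 a0 h.
have := sqr_ge0 (a - b); nra.
Qed.

Lemma second_momentB X Y : strongly_measurable X -> strongly_measurable Y ->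
  second_moment P (fun w => X w - Y w)%R <=
  2%:E * second_moment P X + 2%:E * second_moment P Y.
Proof.
move=> mX mY; have mN : strongly_measurable (fun w => - Y w)%R.
  have := strongly_measurableB (strongly_measurable_cst _ 0%R) mY.
  by congr strongly_measurable; apply/funext => w; rewrite sub0r.
apply: le_trans (second_momentD mX mN) _.
rewrite leeD2l// lee_pmul2l//; apply: second_moment_le => // w.
by rewrite rnormN.
Qed.

Lemma second_moment_distC X Y :
  second_moment P (fun w => X w - Y w)%R = second_moment P (fun w => Y w - X w)%R.
Proof.
by rewrite !second_momentE; apply: eq_integral => w _; rewrite -rnormN opprB.
Qed.

Lemma cvg_sqr_rnorm (x : nat -> E) (y : E) : x n @[n --> \oo] --> y ->
  (rnorm (x n) ^+ 2)%:E @[n --> \oo] --> (rnorm y ^+ 2)%:E.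
Proof.
move=> xy; apply: cvg_EFin; first exact: nearW.
have h : (rnorm (x n) ^+ 2)%R @[n --> \oo] --> (rnorm y ^+ 2)%R.
  by under eq_fun do rewrite expr2; rewrite expr2; apply: cvgM; exact: cvg_rnorm.
exact: h.
Qed.

(** Fatou's lemma, with the inferior limit of the second moments replaced by an
    eventual upper bound. *)
Lemma second_moment_fatou (X : nat -> Om -> E) Y (c : \bar R) :
  (forall n, strongly_measurable (X n)) ->
  (forall w, X n w @[n --> \oo] --> Y w) ->
  (\forall n \near \oo, second_moment P (X n) <= c) ->
  second_moment P Y <= c.
Proof.
move=> mX XY Xc.
pose f n w := (rnorm (X n w) ^+ 2)%:E.
have mf n : measurable_fun setT (f n) by exact: measurable_sqr_rnorm.
have f0 n w : setT w -> 0 <= f n w by rewrite lee_fin sqr_ge0.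
rewrite second_momentE (eq_integral (fun w => limn_einf (f ^~ w))); last first.
  move=> w _; have fl := cvg_sqr_rnorm (XY w).
  by rewrite is_cvg_limn_einfE; [exact/esym/cvg_lim|exact: cvgP fl].
apply: le_trans (fatou P measurableT mf f0) _.
rewrite limn_einf_lim; apply: lime_le; first exact: is_cvg_einfs.
apply: filterS Xc => n; rewrite second_momentE => h; apply: le_trans h.
by apply: ereal_inf_lbound; exists n => /=.
Qed.

End second_moment_theory.

Lemma rnorm0 (R : realType) (V : normedModType R[i]) : rnorm (0 : V) = 0.
Proof. by rewrite /rnorm normr0. Qed.

Lemma rnorm_le0 (R : realType) (V : normedModType R[i]) (x : V) : rnorm x <= 0 -> x = 0.
Proof.
move=> x0; apply/eqP; rewrite -normr_eq0 rnormE (_ : rnorm x = 0)//.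
by apply/eqP; rewrite eq_le x0 rnorm_ge0.
Qed.

Section second_moment_complete.
Context dO (Om : measurableType dO) (R : realType) (P : probability Om R).
Context {E : completeNormedModType R[i]}.
Implicit Types X Y : Om -> E.
Local Open Scope ereal_scope.

Lemma simple_strongly_measurable (s : Om -> E) :
  simple_fun s -> strongly_measurable s.
Proof. by move=> ss; exists (fun=> s) => // w; exact: cvg_cst. Qed.

Lemma simple_fun_if (b : Om -> bool) (s : Om -> E) :
  measurable_fun setT b -> simple_fun s ->
  simple_fun (fun w => if b w then s w else 0%R).
Proof.
move=> mb ss; apply: (simple_fun2 (fun (c : bool) v => if c then v else 0%R)) ss.
split=> [|c]; first exact: finite_finset.
by rewrite -[X in measurable X]setTI; exact: mb.
Qed.

(** Truncating the approximations where they exceed twice the target makes them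
    dominated by it. *)
Lemma simple_dense X (eps : R) : strongly_measurable X ->
  second_moment P X < +oo -> (0 < eps)%R ->
  exists2 s, simple_fun s & second_moment P (fun w => X w - s w)%R <= eps%:E.
Proof.
move=> mX Xoo eps0; have [s ss sX] := mX.
pose b n w := (rnorm (s n w) <= 2 * rnorm (X w))%R.
have mb n : measurable_fun setT (b n).
  apply: measurable_fun_ler.
    by apply: measurable_rnorm; exact: simple_strongly_measurable.
  by apply: measurable_funM => //; exact: measurable_rnorm.
pose t n w := if b n w then s n w else 0%R.
have st n : simple_fun (t n) by exact: simple_fun_if.
have tX w : t n w @[n --> \oo] --> X w.
  have [X0|X0] := eqVneq (rnorm (X w)) 0%R.
    have Xw0 : X w = 0%R by apply: rnorm_le0; rewrite X0.
    rewrite Xw0; apply: cvg_near_cst; apply: nearW => n.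
    rewrite /t /b X0 mulr0; case: ifPn => // sn.
    exact: rnorm_le0.
  apply: cvg_trans (sX w); apply: near_eq_cvg.
  have lt2 : (rnorm (X w) < 2 * rnorm (X w))%R.
    by rewrite mulr_natl mulr2n ltrDl lt_def X0 rnorm_ge0.
  have nb : \forall n \near \oo, (rnorm (s n w) <= 2 * rnorm (X w))%R.
    by have /cvgr_le := cvg_rnorm (sX w); exact.
  by near=> n; rewrite /t /b; case: ifP => // /negP; case; near: n.
pose f n w := (rnorm (X w - t n w) ^+ 2)%:E.
have mXt n : strongly_measurable (fun w => X w - t n w)%R.
  by apply: strongly_measurableB => //; exact: simple_strongly_measurable.
have mf n : measurable_fun setT (f n) by exact: (measurable_sqr_rnorm (mXt n)).
have f0 w : setT w -> f n w @[n --> \oo] --> 0.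
  move=> _; have h0 : (X w - t n w)%R @[n --> \oo] --> (0%R : E).
    by rewrite -(subrr (X w)); apply: cvgB => //; exact: cvg_cst.
  by have := cvg_sqr_rnorm h0; rewrite rnorm0 expr0n/=; exact.
have I2 : P.-integrable setT (fun w => 9%:E * (rnorm (X w) ^+ 2)%:E).
  apply: integrableZl => //; apply/integrableP; split; first exact: measurable_sqr_rnorm.
  under eq_integral do rewrite gee0_abs ?lee_fin ?sqr_ge0//.
  by rewrite -second_momentE.
have fle n w : setT w -> `|f n w| <= 9%:E * (rnorm (X w) ^+ 2)%:E.
  move=> _; rewrite gee0_abs; last by rewrite lee_fin sqr_ge0.
  rewrite lee_fin.
  have h : (rnorm (t n w) <= 2 * rnorm (X w))%R.
    by rewrite /t /b; case: ifP => //; rewrite rnorm0 mulr_ge0 ?rnorm_ge0.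
  have := rnormD (X w) (- t n w)%R; rewrite rnormN.
  have := rnorm_ge0 (X w - t n w)%R; have := rnorm_ge0 (X w).
  set x := rnorm _; set y := rnorm _ => x0 y0 h'.
  have : (y <= 3 * x)%R by lra.
  by nra.
have fin9 w : setT w -> (9%:E * (rnorm (X w) ^+ 2)%:E : \bar R) \is a fin_num by [].
have := dominated_cvg measurableT mf f0 fin9 I2 fle.
rewrite integral0 => /fine_cvgP[fin /cvgr_le /(_ _ eps0)] le_eps.
have [n _ /(_ n (leqnn n))/= [nfin nle]] : \forall n \near \oo,
    \int[P]_w f n w \is a fin_num /\ (fine (\int[P]_w f n w) <= eps)%R.
  by apply: filterS2 fin le_eps.
by exists (t n) => //; rewrite second_momentE -[leLHS]fineK// lee_fin.
Unshelve. all: by end_near. Qed.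

(** The increments are summable, so the sequence is Cauchy; the constant [C] may
    depend on the sequence, that is, on the point of the probability space. *)
Lemma geometric_cvg (u : nat -> E) (C : R) :
  (forall n, rnorm (u n.+1 - u n) <= C / 2 ^+ n)%R -> cvgn u.
Proof.
move=> h; apply/cauchy_cvgP/cauchy_exP => e e0.
have [r r0 re] : exists2 r : R, (0 < r)%R & r%:C = e.
  exists (complex.Re e); first by move: e0; rewrite ltcE => /andP[].
  by move: e0; case: (e) => a b; rewrite ltcE/= => /andP[/eqP->].
have hd p k : (rnorm (u (p + k)%N - u p) <= 2 * C / 2 ^+ p - 2 * C / 2 ^+ (p + k))%R.
  elim: k => [|k ih]; first by rewrite addn0 !subrr rnorm0.
  rewrite addnS -[X in (X - _)%R](subrK (u (p + k)%N)) -addrA.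
  apply: le_trans (rnormD _ _) _; apply: le_trans (lerD (h _) ih) _.
  rewrite exprS le_eqVlt; apply/orP; left; apply/eqP; field.
  by rewrite !expf_neq0 ?pnatr_eq0.
have C0 : (0 <= C)%R by have := h 0%N; rewrite expr0 divr1; apply: le_trans; exact: rnorm_ge0.
have : (2 * C / 2 ^+ p @[p --> \oo] --> (0 : R))%R.
  rewrite -[X in _ --> X](mulr0 (2 * C)%R); apply: cvgMr.
  by under eq_fun do rewrite -exprVn; apply: cvg_expr; rewrite ger0_norm; lra.
move=> /cvgr_lt /(_ _ r0) [p _ /(_ p (leqnn p)) /= hp].
exists (u p); exists p => // n /= pn.
rewrite -ball_normE /ball_ /= rnormE -re ltcR -rnormN opprB.
rewrite -(subnKC pn); apply: le_lt_trans (hd _ _) _; apply: le_lt_trans hp.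
by rewrite gerBl divr_ge0 ?mulr_ge0.
Qed.

(** Riesz-Fischer argument: the weighted sum of the squared increments has a
    finite integral, so it is finite almost surely, which forces geometric decay
    of the increments. Replacing the functions by 0 on the exceptional null set
    keeps them simple and makes them converge everywhere, as the notion of strong
    measurability in use demands. *)
Lemma fast_cauchy_limit (s : nat -> Om -> E) :
  (forall n, simple_fun (s n)) ->
  (forall n, second_moment P (fun w => s n.+1 w - s n w)%R <= (16 / 8 ^+ n)%:E) ->
  exists t X, [/\ forall n, simple_fun (t n),
    forall w, t n w @[n --> \oo] --> X w &
    {ae P, forall w, forall n, t n w = s n w}].
Proof.
move=> ss sdist.
pose f n w := (4 ^+ n * rnorm (s n.+1 w - s n w) ^+ 2)%:E.
have mds n : strongly_measurable (fun w => s n.+1 w - s n w)%R.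
  by apply: strongly_measurableB; exact: simple_strongly_measurable.
have mf n : measurable_fun setT (f n).
  apply/measurable_EFinP; apply: measurable_funM => //; apply: measurable_funX.
  exact: (measurable_rnorm (mds n)).
have f0 n w : setT w -> 0 <= f n w.
  by move=> _; rewrite lee_fin; apply: mulr_ge0; rewrite ?sqr_ge0 ?exprn_ge0.
have If n : \int[P]_w f n w <= (32 / (2 ^ n.+1)%:R)%:E.
  have -> : \int[P]_w f n w =
      (4 ^+ n)%:E * second_moment P (fun w => s n.+1 w - s n w)%R.
    rewrite second_momentE -ge0_integralZl_EFin ?exprn_ge0//.
    - by move=> w _; rewrite lee_fin sqr_ge0.
    - exact: (measurable_sqr_rnorm (mds n)).
  apply: le_trans (lee_wpmul2l _ (sdist n)) _; first by rewrite lee_fin exprn_ge0.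
  rewrite -EFinM lee_fin natrX exprS (_ : 8 = 4 * 2 :> R)%R ?exprMn; last by ring.
  by rewrite le_eqVlt; apply/orP; left; apply/eqP; field; rewrite !expf_neq0 ?pnatr_eq0.
pose h w := \sum_(n <oo) f n w.
have h0 w : 0 <= h w by apply: nneseries_ge0 => n _ _; exact: f0.
have mh : measurable_fun setT h.
  by apply: (ge0_emeasurable_sum (P := xpredT)) => // n w Dw _; exact: f0.
have Ih : P.-integrable setT h.
  apply/integrableP; split => //.
  under eq_integral do rewrite gee0_abs//.
  rewrite integral_nneseries//; apply: (@le_lt_trans _ _ 32%:E); last exact: ltry.
  apply: le_trans (epsilon_trick0 xpredT _) => //.
  by apply: lee_nneseries => [n _ _|n _]; [apply: integral_ge0 => w; exact: f0|exact: If].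
pose b w := h w < +oo.
have mb : measurable_fun setT b by apply: measurable_fun_lte.
pose t n w := if b w then s n w else 0%R.
have tcvg w : cvgn (t ^~ w).
  have [bw|/negbTE bw] := boolP (b w); last first.
    rewrite (_ : t ^~ w = fun=> 0%R); first exact: is_cvg_cst.
    by apply/funext => n; rewrite /t bw.
  rewrite (_ : t ^~ w = s ^~ w); last by apply/funext => n; rewrite /t bw.
  have hw : h w \is a fin_num by rewrite ge0_fin_numE.
  apply: (@geometric_cvg _ (Num.sqrt (fine (h w)))) => n.
  have fh : (4 ^+ n * rnorm (s n.+1 w - s n w) ^+ 2 <= fine (h w))%R.
    rewrite -lee_fin fineK// -/(f n w).
    have := @nneseries_lim_ge _ (f ^~ w) xpredT 0%N n.+1 (fun k _ _ => f0 k w Logic.I).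
    apply: le_trans; rewrite big_nat_recr//= leeDr//.
    by apply: sume_ge0 => k _; exact: f0.
  have fh0 : (0 <= fine (h w))%R by rewrite fine_ge0.
  rewrite -(@ler_sqr R) ?nnegrE ?rnorm_ge0 ?divr_ge0 ?sqrtr_ge0 ?exprn_ge0//.
  rewrite exprMn exprVn -exprM mulnC exprM sqr_sqrtr// ler_pdivlMr ?exprn_gt0//.
  by rewrite mulrC (_ : 2 ^+ 2 = 4 :> R)%R//; ring.
exists t, (fun w => limn (t ^~ w)); split.
- by move=> n; exact: simple_fun_if.
- by move=> w; exact: tcvg.
- apply: filterS (integrable_ae measurableT Ih) => w /(_ Logic.I) hfin n.
  by rewrite /t /b ltey_eq hfin.
Qed.

(** Approximating a fast subsequence by simple functions yields a limit that is
    strongly measurable by construction. *)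
Lemma second_moment_complete (S : nat -> Om -> E) :
  (forall n, strongly_measurable (S n)) ->
  (forall n, second_moment P (S n) < +oo) ->
  (forall eps : R, (0 < eps)%R -> exists N, forall p q, (N <= p)%N -> (N <= q)%N ->
    second_moment P (fun w => S p w - S q w)%R <= eps%:E) ->
  exists X, [/\ strongly_measurable X, second_moment P X < +oo &
    second_moment P (fun w => S n w - X w)%R @[n --> \oo] --> 0].
Proof.
move=> mS Soo Scauchy.
have d0 n : (0 < 1 / 8 ^+ n :> R)%R by rewrite divr_gt0// exprn_gt0.
have /choice[sN sNP] : forall n, exists a : (Om -> E) * nat, simple_fun a.1 /\
    forall p, (a.2 <= p)%N -> second_moment P (fun w => S p w - a.1 w)%R <= (4 / 8 ^+ n)%:E.
  move=> n; have [N hN] := Scauchy _ (d0 n).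
  have [s ss sS] := simple_dense (mS N) (Soo N) (d0 n).
  exists (s, N); split => // p Np /=.
  have ms := simple_strongly_measurable ss.
  have := second_momentD P (strongly_measurableB (mS p) (mS N))
    (strongly_measurableB (mS N) ms).
  under eq_fun do rewrite subrKA.
  move=> /le_trans; apply.
  have -> : (4 / 8 ^+ n)%:E = 2%:E * (1 / 8 ^+ n)%:E + 2%:E * (1 / 8 ^+ n)%:E :> \bar R.
    by rewrite -!EFinM -EFinD; congr EFin; field; rewrite expf_neq0 ?pnatr_eq0.
  by apply: leeD; rewrite lee_pmul2l//; exact: hN.
pose s n := (sN n).1.
have ss n : simple_fun (s n) := (sNP n).1.
have ms n := simple_strongly_measurable (ss n).
have sdist n : second_moment P (fun w => s n.+1 w - s n w)%R <= (16 / 8 ^+ n)%:E.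
  pose p := maxn (sN n.+1).2 (sN n).2.
  have h1 := (sNP n.+1).2 p (leq_maxl _ _).
  have h2 := (sNP n).2 p (leq_maxr _ _).
  rewrite second_moment_distC in h1.
  have := second_momentD P (strongly_measurableB (ms n.+1) (mS p))
    (strongly_measurableB (mS p) (ms n)).
  under eq_fun do rewrite subrKA.
  move=> /le_trans; apply.
  have -> : (16 / 8 ^+ n)%:E = 2%:E * (4 / 8 ^+ n)%:E + 2%:E * (4 / 8 ^+ n)%:E :> \bar R.
    by rewrite -!EFinM -EFinD; congr EFin; field; rewrite expf_neq0 ?pnatr_eq0.
  apply: leeD; rewrite lee_pmul2l//. move: h1 => /le_trans; apply.
  rewrite lee_fin ler_pM2l// lef_pV2 ?posrE ?exprn_gt0//.
  by rewrite ler_eXn2l ?ltr1n.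
have [t [X [st tX ts]]] := fast_cauchy_limit ss sdist.
have mX : strongly_measurable X by exists t.
have SX n p : ((sN n).2 <= p)%N ->
    second_moment P (fun w => S p w - X w)%R <= (40 / 8 ^+ n)%:E.
  move=> np; apply: (@second_moment_fatou _ _ _ P _ (fun k w => S p w - t k w)%R).
  - by move=> k; apply: strongly_measurableB => //; exact: simple_strongly_measurable.
  - by move=> w; apply: cvgB; [exact: cvg_cst|exact: tX].
  exists n => // k /= nk.
  have -> : second_moment P (fun w => S p w - t k w)%R =
      second_moment P (fun w => S p w - s k w)%R.
    rewrite !second_momentE; apply: ge0_ae_eq_integral => //.
    - by apply: (measurable_sqr_rnorm (strongly_measurableB (mS p) _));
        exact: simple_strongly_measurable.
    - by apply: (measurable_sqr_rnorm (strongly_measurableB (mS p) _)).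
    - by move=> w _; rewrite lee_fin sqr_ge0.
    - by move=> w _; rewrite lee_fin sqr_ge0.
    by apply: filterS ts => w -> _.
  pose q := maxn (sN n).2 (sN k).2.
  have hpq : second_moment P (fun w => S p w - S q w)%R <= (16 / 8 ^+ n)%:E.
    have h1 := (sNP n).2 p np.
    have := (sNP n).2 q (leq_maxl _ _); rewrite second_moment_distC => h2.
    have := second_momentD P (strongly_measurableB (mS p) (ms n))
      (strongly_measurableB (ms n) (mS q)).
    under eq_fun do rewrite subrKA.
    move=> /le_trans; apply.
    have -> : (16 / 8 ^+ n)%:E = 2%:E * (4 / 8 ^+ n)%:E + 2%:E * (4 / 8 ^+ n)%:E :> \bar R.
      by rewrite -!EFinM -EFinD; congr EFin; field; rewrite expf_neq0 ?pnatr_eq0.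
    by apply: leeD; rewrite lee_pmul2l.
  have hqk := (sNP k).2 q (leq_maxr _ _).
  have := second_momentD P (strongly_measurableB (mS p) (mS q))
    (strongly_measurableB (mS q) (ms k)).
  under eq_fun do rewrite subrKA.
  move=> /le_trans; apply.
  have -> : (40 / 8 ^+ n)%:E = 2%:E * (16 / 8 ^+ n)%:E + 2%:E * (4 / 8 ^+ n)%:E :> \bar R.
    by rewrite -!EFinM -EFinD; congr EFin; field; rewrite expf_neq0 ?pnatr_eq0.
  apply: leeD; rewrite lee_pmul2l//; apply: (le_trans hqk).
  by rewrite lee_fin ler_pM2l// lef_pV2 ?posrE ?exprn_gt0// ler_eXn2l ?ltr1n.
have Xoo : second_moment P X < +oo.
  have := second_momentB P (mS (sN 0%N).2) (strongly_measurableB (mS (sN 0%N).2) mX).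
  under eq_fun do rewrite opprB addrC subrK.
  move=> /le_lt_trans; apply; apply: lte_add_pinfty; apply: lte_mul_pinfty => //.
  by apply: le_lt_trans (SX 0%N _ (leqnn _)) _; rewrite ltry.
exists X; split => //.
have Xfin n : second_moment P (fun w => S n w - X w)%R \is a fin_num.
  rewrite ge0_fin_numE ?second_moment_ge0//.
  apply: le_lt_trans (second_momentB P (mS n) mX) _.
  by apply: lte_add_pinfty; apply: lte_mul_pinfty.
apply/fine_cvgP; split; first exact: nearW.
apply/cvgrPdist_le => e e0.
have : (40 / 8 ^+ n @[n --> \oo] --> (0 : R))%R.
  rewrite -[X in _ --> X](mulr0 40%R); apply: cvgMr.
  by under eq_fun do rewrite -exprVn; apply: cvg_expr; rewrite ger0_norm; lra.
move=> /cvgr_le /(_ _ e0) [n _ /(_ n (leqnn n)) /= hn].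
exists (sN n).2 => // p /= np.
rewrite sub0r normrN ger0_norm ?fine_ge0 ?second_moment_ge0//.
by apply: le_trans hn; rewrite -lee_fin fineK//; exact: SX.
Qed.

End second_moment_complete.

(** * Complex coefficients *)

Lemma big_iota0 (V : nmodType) (F : nat -> V) m :
  \sum_(j <- iota 0 m) F j = \sum_(j < m) F j.
Proof. by rewrite -(big_mkord xpredT) /index_iota subn0. Qed.

Section complex_contraction.
Context dO (Om : measurableType dO) (R : realType) (P : probability Om R).
Variable g : nat -> {RV P >-> R}.
Hypothesis gaussian_g : gaussian_sequence g.
Context {E : completeNormedModType R[i]}.
Local Open Scope ereal_scope.

Definition sqmod (z : R[i]) : R := (complex.Re z ^+ 2 + complex.Im z ^+ 2)%R.

Lemma sqmod_ge0 z : (0 <= sqmod z)%R.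
Proof. by rewrite addr_ge0 ?sqr_ge0. Qed.

Let rsum (a : nat -> nat -> R) (y : nat -> E) m n : E :=
  (\sum_(j < m) (a n j)%:C *: y j)%R.

(** The contraction principle, rescaled to a coefficient matrix of operator norm
    at most [sqrt M] and translated to the partial sums of Gaussian series. *)
Lemma second_moment_real_contraction (a : nat -> nat -> R) (y : nat -> E) N m (M : R) :
  (0 < M)%R ->
  (forall c : nat -> R, \sum_(j < m) (\sum_(n < N) c n * a n j) ^+ 2 <=
     M * \sum_(n < N) c n ^+ 2)%R ->
  second_moment P (gamma_psum g (rsum a y m) N) <=
  M%:E * second_moment P (gamma_psum g y m).
Proof.
move=> M0 ha; set r := Num.sqrt M.
have r0 : (0 < r)%R by rewrite sqrtr_gt0.
have r2 : (r ^+ 2 = M)%R by rewrite sqr_sqrtr// ltW.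
pose u : seq (E * (nat -> R)) := [seq (r%:C *: y j, fun n => a n j / r)%R | j <- iota 0 m].
have hu c : (column_sqnorm N c u <= \sum_(n < N) c n ^+ 2)%R.
  rewrite -(ler_pM2l M0); apply: le_trans (ha c).
  rewrite /column_sqnorm big_map big_iota0 mulr_sumr.
  apply: ler_sum => j _ /=.
  under eq_bigr do rewrite mulrA; rewrite -mulr_suml exprMn exprVn r2.
  by rewrite mulrCA divff ?mulr1// gt_eqF.
have := gauss_moment_contraction 0%R hu.
have -> : [seq combination u n | n <- iota 0 N] = [seq rsum a y m n | n <- iota 0 N].
  apply: eq_map => n; rewrite /combination big_map big_iota0.
  by apply: eq_bigr => j _ /=; rewrite scalerA -rmorphM/= divfK// gt_eqF.
have -> : map fst u = [seq (fun j => r%:C *: y j)%R j | j <- iota 0 m].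
  by rewrite /u -map_comp.
rewrite -!(second_moment_gamma_psum gaussian_g) => /le_trans; apply.
apply: le_trans (second_momentZ P (ltW M0) (strongly_measurable_gamma_psum g y m)).
rewrite le_eqVlt; apply/orP; left; apply/eqP; congr second_moment.
apply/funext => w; rewrite /gamma_psum scaler_sumr; apply: eq_bigr => j _.
by rewrite !scalerA mulrC.
Qed.

(** The Gaussian variables are real, so real and imaginary parts of the complex
    coefficients are treated separately; this costs the factor 4. *)
Lemma second_moment_complex_contraction (a : nat -> nat -> R[i]) (y : nat -> E) N m (M : R) :
  (0 < M)%R ->
  (forall c : nat -> R, \sum_(j < m) sqmod (\sum_(n < N) (c n)%:C * a n j) <=
     M * \sum_(n < N) c n ^+ 2)%R ->
  second_moment P (gamma_psum g (fun n => \sum_(j < m) a n j *: y j)%R N) <=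
  (4 * M)%:E * second_moment P (gamma_psum g y m).
Proof.
move=> M0 ha.
pose aR n j := complex.Re (a n j); pose aI n j := complex.Im (a n j).
have ReE c j : complex.Re (\sum_(n < N) (c n)%:C * a n j)%R = (\sum_(n < N) c n * aR n j)%R.
  by rewrite raddf_sum; apply: eq_bigr => n _; rewrite /aR; case: (a n j) => p q /=; ring.
have ImE c j : complex.Im (\sum_(n < N) (c n)%:C * a n j)%R = (\sum_(n < N) c n * aI n j)%R.
  by rewrite raddf_sum; apply: eq_bigr => n _; rewrite /aI; case: (a n j) => p q /=; ring.
set V := second_moment P (gamma_psum g y m).
have sR (c : nat -> R) : (\sum_(j < m) (\sum_(n < N) c n * aR n j) ^+ 2 <= M * \sum_(n < N) c n ^+ 2)%R.
  apply: le_trans (ha c); apply: ler_sum => j _.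
  by rewrite /sqmod ReE lerDl sqr_ge0.
have sI (c : nat -> R) : (\sum_(j < m) (\sum_(n < N) c n * aI n j) ^+ 2 <= M * \sum_(n < N) c n ^+ 2)%R.
  apply: le_trans (ha c); apply: ler_sum => j _.
  by rewrite /sqmod ImE lerDr sqr_ge0.
have hR := second_moment_real_contraction y M0 sR.
have hI := second_moment_real_contraction y M0 sI.
pose X := gamma_psum g (rsum aR y m) N; pose Z := gamma_psum g (rsum aI y m) N.
have mX : strongly_measurable X by exact: strongly_measurable_gamma_psum.
have mZ : strongly_measurable Z by exact: strongly_measurable_gamma_psum.
have miZ : strongly_measurable (fun w => 'i *: Z w)%R.
  have := strongly_measurable_lin 'i mZ (strongly_measurable_cst _ 0%R).
  by congr strongly_measurable; apply/funext => w; rewrite addr0.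
have -> : gamma_psum g (fun n => \sum_(j < m) a n j *: y j)%R N =
    (fun w => X w + 'i *: Z w)%R.
  apply/funext => w; rewrite /X /Z /gamma_psum scaler_sumr -big_split/=.
  apply: eq_bigr => n _; rewrite /rsum !scaler_sumr -big_split/=.
  apply: eq_bigr => j _; rewrite !scalerA -scalerDl; congr (_ *: _)%R.
  by rewrite /aR /aI; case: (a n j) => p q; congr (_ +i* _)%R => /=; ring.
apply: le_trans (second_momentD P mX miZ) _.
have -> : (4 * M)%:E * V = 2%:E * (M%:E * V) + 2%:E * (M%:E * V).
  rewrite EFinM -muleA (_ : 4%:E = 2%:E + 2%:E :> \bar R) ?ge0_muleDl//.
  by rewrite -EFinD; congr EFin; ring.
apply: leeD; rewrite lee_pmul2l//.
apply: le_trans hI; apply: second_moment_le => // w.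
by rewrite rnormZ normc_def /= expr0n expr1n/= add0r sqrtr1 mul1r.
Qed.

End complex_contraction.

(** * Orthogonal families and Fourier expansions *)

Section inner_product_geometry.
Context {R : realType} {K : innerProductType R}.
Implicit Types (x y z : K) (f k : nat -> K) (M : R).

Definition sqnorm x : R := complex.Re (inner x x).

Lemma inner_sqnorm x : inner x x = (sqnorm x)%:C.
Proof.
rewrite /sqnorm; have := inner_conj x x; case: (inner x x) => a b [] /eqP.
by rewrite -subr_eq0 opprK -mulr2n mulrn_eq0/= => /eqP ->.
Qed.

Lemma inner0r x : inner x 0 = 0 :> R[i].
Proof. by rewrite inner_conj inner0l conjc0. Qed.

Lemma sqnorm0 : sqnorm 0 = 0.
Proof. by rewrite /sqnorm inner0l. Qed.

Lemma sqnorm_ge0 x : 0 <= sqnorm x.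
Proof.
have [->|x0] := eqVneq x 0; first by rewrite sqnorm0.
by have := inner_gt0 _ x0; rewrite inner_sqnorm ltcR => /ltW.
Qed.

Lemma inorm_ge0 x : 0 <= inorm x.
Proof. exact: sqrtr_ge0. Qed.

Lemma sqr_inorm x : inorm x ^+ 2 = sqnorm x.
Proof. by rewrite /inorm sqr_sqrtr// sqnorm_ge0. Qed.

Lemma sqnormZ (a : R[i]) x : sqnorm (a *: x) = sqmod a * sqnorm x.
Proof.
rewrite {1}/sqnorm innerZl innerZr inner_sqnorm /sqmod.
by case: a => a b /=; ring.
Qed.

Lemma sqnormD x y : sqnorm (x + y) = sqnorm x + sqnorm y + 2 * complex.Re (inner x y).
Proof.
rewrite /sqnorm !innerDl !innerDr (inner_conj x y).
by case: (inner x x) => ? ?; case: (inner y y) => ? ?; case: (inner x y) => ? ? /=; ring.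
Qed.

Lemma inner_suml N (d : nat -> R[i]) f y :
  inner (\sum_(n < N) d n *: f n) y = \sum_(n < N) d n * inner (f n) y.
Proof.
elim: N => [|N ih]; first by rewrite !big_ord0 inner0l.
by rewrite !big_ord_recr/= innerDl innerZl ih.
Qed.

Lemma inner_sumr N (d : nat -> R[i]) f y :
  inner y (\sum_(n < N) d n *: f n) = \sum_(n < N) conjc (d n) * inner y (f n).
Proof.
elim: N => [|N ih]; first by rewrite !big_ord0 inner0r.
by rewrite !big_ord_recr/= innerDr innerZr ih.
Qed.

Definition orthogonal_bounded f M :=
  (forall i j, i != j -> inner (f i) (f j) = 0 :> R[i]) /\
  forall i, sqnorm (f i) <= M.

Lemma orthonormal_bounded f :
  (forall i j, inner (f i) (f j) = (i == j)%:R :> R[i]) -> orthogonal_bounded f 1.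
Proof.
move=> oF; split=> [i j /negbTE ij|i]; first by rewrite oF ij.
by rewrite /sqnorm oF eqxx.
Qed.

Lemma sqnorm_orthogonal_sum f M N (d : nat -> R[i]) : orthogonal_bounded f M ->
  sqnorm (\sum_(n < N) d n *: f n) = \sum_(n < N) sqmod (d n) * sqnorm (f n).
Proof.
move=> [oF _]; elim: N => [|N ih]; first by rewrite !big_ord0 sqnorm0.
have z : inner (\sum_(n < N) d n *: f n) (d N *: f N) = 0 :> R[i].
  rewrite inner_suml big1// => n _.
  by rewrite innerZr oF ?mulr0// ltn_eqF.
by rewrite !big_ord_recr/= sqnormD ih sqnormZ z mulr0 addr0.
Qed.

(** Bessel's inequality, for vectors that are orthogonal but not normalised:
    expand the squared norm of [x - M^-1 * \sum_n <x, f n> f n]. *)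
Lemma bessel f M N x : 0 < M -> orthogonal_bounded f M ->
  \sum_(n < N) sqmod (inner x (f n)) <= M * sqnorm x.
Proof.
move=> M0 fM; set S := \sum_(n < N) _.
pose d n := - (M^-1)%:C * inner x (f n).
have dE n : sqmod (d n) = M^-1 ^+ 2 * sqmod (inner x (f n)).
  by rewrite /sqmod /d; case: inner => p q /=; ring.
have hs : sqnorm (\sum_(n < N) d n *: f n) <= M^-1 * S.
  rewrite (sqnorm_orthogonal_sum _ _ fM) mulr_sumr; apply: ler_sum => n _.
  rewrite dE expr2 -!mulrA; apply: ler_wpM2l; first by rewrite invr_ge0 ltW.
  rewrite mulrCA; apply: ler_piMr; first exact: sqmod_ge0.
  by rewrite mulrC ler_pdivrMr// mul1r; case: fM.
have hi : complex.Re (inner x (\sum_(n < N) d n *: f n)) = - (M^-1 * S).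
  rewrite inner_sumr raddf_sum mulr_sumr -sumrN; apply: eq_bigr => n _.
  by rewrite /d /sqmod; case: inner => p q /=; ring.
have := sqnorm_ge0 (x + \sum_(n < N) d n *: f n).
rewrite sqnormD hi => h.
by rewrite -ler_pdivrMl//; lra.
Qed.

(** The coefficient matrix of an orthogonal family with respect to an orthonormal
    one is, up to the factor [sqrt M], a contraction. *)
Lemma bessel_contraction f M k N m (c : nat -> R) : orthogonal_bounded f M ->
  orthogonal_bounded k 1 ->
  \sum_(j < m) sqmod (\sum_(n < N) (c n)%:C * inner (f n) (k j)) <=
  M * \sum_(n < N) c n ^+ 2.
Proof.
move=> fM k1; set x := \sum_(n < N) (c n)%:C *: f n.
under eq_bigr do rewrite -(inner_suml _ (fun n => (c n)%:C)).
apply: le_trans (bessel m x ltr01 k1) _; rewrite mul1r.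
rewrite (sqnorm_orthogonal_sum _ (fun n => (c n)%:C) fM) mulr_sumr.
apply: ler_sum => n _; rewrite /sqmod /= expr0n/= addr0 mulrC.
by apply: ler_wpM2r; [exact: sqr_ge0|case: fM].
Qed.

Definition expansion k m x : K := \sum_(j < m) inner x (k j) *: k j.

Lemma expansion_residual k m x j :
  (forall i j, (i < m)%N -> (j < m)%N -> inner (k i) (k j) = (i == j)%:R :> R[i]) ->
  (j < m)%N -> inner (x - expansion k m x) (k j) = 0 :> R[i].
Proof.
move=> ok jm; rewrite innerDl -scaleN1r innerZl.
rewrite /expansion (inner_suml _ (fun j => inner x (k j))).
rewrite (bigD1 (Ordinal jm))//= ok// eqxx big1 => [|i ij].
  by rewrite mulr1 addr0 mulN1r subrr.
by move: ij; rewrite -val_eqE /= ok// => /negbTE ->; rewrite mulr0.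
Qed.

(** Fourier partial sums are best approximations; orthonormality is only asked of
    the vectors in use, so that this applies while a basis is being built. *)
Lemma expansion_best k n m x (c : 'I_n -> R[i]) :
  (forall i j, (i < m)%N -> (j < m)%N -> inner (k i) (k j) = (i == j)%:R :> R[i]) ->
  (n <= m)%N ->
  inorm (x - expansion k m x) <= inorm (x - \sum_(i < n) c i *: k i).
Proof.
move=> ok nm; pose c' j := if insub j is Some i then c i else 0.
have -> : \sum_(i < n) c i *: k i = \sum_(j < m) c' j *: k j.
  transitivity (\sum_(i < n) c' i *: k i).
    by apply: eq_bigr => i _; rewrite /c' valK.
  rewrite (big_ord_widen m (fun j => c' j *: k j) nm) big_mkcond/=.
  apply: eq_bigr => j _; case: ifPn => // jn.
  by rewrite /c' insubN// scale0r.
set y := x - expansion k m x.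
have oy j : (j < m)%N -> inner y (k j) = 0 by exact: expansion_residual.
pose d j := inner x (k j) - c' j.
have -> : x - \sum_(j < m) c' j *: k j = y + \sum_(j < m) d j *: k j.
  rewrite /y -addrA; congr (_ + _); rewrite /expansion addrC.
  rewrite -sumrB -sumrN; apply: eq_bigr => j _.
  by rewrite /d scalerBl addrAC subrr sub0r.
have z : inner y (\sum_(j < m) d j *: k j) = 0 :> R[i].
  by rewrite inner_sumr big1// => j _; rewrite oy// mulr0.
apply: ler_wsqrtr; rewrite -![complex.Re _]/(sqnorm _) sqnormD z.
by rewrite /= mulr0 addr0 lerDl sqnorm_ge0.
Qed.

Lemma expansion_cvg k x (eps : R) : orthonormal_basis k -> 0 < eps ->
  \forall m \near \oo, inorm (x - expansion k m x) < eps.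
Proof.
move=> [ok dk] e0; have [n [c hc]] := dk x _ e0.
by exists n => // m /= nm; exact: le_lt_trans (expansion_best x c (fun i j _ _ => ok i j) nm) hc.
Qed.

End inner_product_geometry.

(** * The ideal property along orthogonal sequences *)

Section auxiliary_sums.
Context {R : realType}.

Lemma sqmod_conj (z : R[i]) : sqmod (conjc z) = sqmod z.
Proof. by case: z => a b; rewrite /sqmod /= sqrrN. Qed.

Lemma cauchy_schwarz_sum (N : nat) (c d : nat -> R) :
  (\sum_(n < N) c n * d n) ^+ 2 <= (\sum_(n < N) c n ^+ 2) * (\sum_(n < N) d n ^+ 2).
Proof.
elim: N => [|N ih]; first by rewrite !big_ord0 expr0n mulr0.
rewrite !big_ord_recr/=; move: ih.
have : 0 <= \sum_(n < N) c n ^+ 2 by apply: sumr_ge0 => n _; exact: sqr_ge0.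
have : 0 <= \sum_(n < N) d n ^+ 2 by apply: sumr_ge0 => n _; exact: sqr_ge0.
set D := \sum_(n < N) d n ^+ 2; set C := \sum_(n < N) c n ^+ 2.
set S := \sum_(n < N) _; set a := c N; set b := d N => D0 C0 SCD.
suff : 2 * (S * (a * b)) <= C * b ^+ 2 + a ^+ 2 * D.
  by move=> h; rewrite sqrrD mulr2n !mulrDl !mulrDr exprMn; lra.
(* arithmetic-geometric mean inequality for [C b^2] and [a^2 D] *)
have h : (2 * (S * (a * b))) ^+ 2 <= (C * b ^+ 2 + a ^+ 2 * D) ^+ 2.
  have : S ^+ 2 * (a * b) ^+ 2 <= (C * D) * (a * b) ^+ 2.
    by apply: ler_wpM2r => //; exact: sqr_ge0.
  have := sqr_ge0 (C * b ^+ 2 - a ^+ 2 * D).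
  by rewrite !expr2; lra.
have nn : 0 <= C * b ^+ 2 + a ^+ 2 * D.
  by apply: addr_ge0; apply: mulr_ge0 => //; exact: sqr_ge0.
apply: le_trans (ler_norm _) _; rewrite -ler_sqr ?nnegrE//.
by rewrite -normrX ger0_norm ?sqr_ge0.
Qed.

Lemma sqmod_sum_le (N : nat) (c : nat -> R) (a : nat -> R[i]) :
  sqmod (\sum_(n < N) (c n)%:C * a n) <=
  (\sum_(n < N) c n ^+ 2) * (\sum_(n < N) sqmod (a n)).
Proof.
have ReE : complex.Re (\sum_(n < N) (c n)%:C * a n) = \sum_(n < N) c n * complex.Re (a n).
  by rewrite raddf_sum; apply: eq_bigr => n _; case: (a n) => p q /=; ring.
have ImE : complex.Im (\sum_(n < N) (c n)%:C * a n) = \sum_(n < N) c n * complex.Im (a n).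
  by rewrite raddf_sum; apply: eq_bigr => n _; case: (a n) => p q /=; ring.
rewrite /sqmod ReE ImE big_split mulrDr.
apply: lerD; first exact: (cauchy_schwarz_sum N c (fun n => complex.Re (a n))).
exact: (cauchy_schwarz_sum N c (fun n => complex.Im (a n))).
Qed.

(** The tail condition is phrased with a test on the index rather than with a
    shifted range, because it is applied to families cut off below [p]. *)
Lemma bounded_series_tail (w : nat -> R) (B delta : R) :
  (forall n, 0 <= w n) -> (forall N, \sum_(n < N) w n <= B) -> 0 < delta ->
  exists N0, forall p q, (N0 <= p)%N ->
    \sum_(n < q) (if (p <= n)%N then w n else 0) <= delta.
Proof.
move=> w0 wB d0; pose s N := \sum_(n < N) w n.
have snd : nondecreasing_seq s.
  by apply/nondecreasing_seqP => n; rewrite /s big_ord_recr/= lerDl.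
have scv : s @ \oo --> limn s.
  by apply: nondecreasing_is_cvgn => //; exists B => _ [n _ <-]; exact: wB.
have /cvgr_ge := scv => /(_ (limn s - delta)).
rewrite ltrBlDr ltrDl => /(_ d0) [N0 _ hN0]; exists N0 => p q Np.
have [qp|pq] := leqP q p.
  rewrite big1 ?ltW// => n _; case: ifPn => // pn.
  by have := leq_ltn_trans (leq_trans qp pn) (ltn_ord n); rewrite ltnn.
have -> : \sum_(n < q) (if (p <= n)%N then w n else 0) = s q - s p.
  rewrite /s -!(big_mkord xpredT w).
  rewrite -(big_mkord xpredT (fun n => if (p <= n)%N then w n else 0)).
  rewrite (big_cat_nat (n := p))//=; last exact: ltnW.
  rewrite big_nat big1 ?add0r => [|i /andP[_ ip]]; last by rewrite leqNgt ip.
  rewrite [X in _ = X - _](big_cat_nat (n := p))//=; last exact: ltnW.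
  by rewrite addrAC subrr add0r; apply: eq_big_nat => i /andP[->].
have sq : s q <= limn s by apply: nondecreasing_cvgn_le => //; exact: cvgP scv.
by have := hN0 p Np; rewrite /=; lra.
Qed.

End auxiliary_sums.

Section ideal_property.
Context dO (Om : measurableType dO) (R : realType) (P : probability Om R).
Variable g : nat -> {RV P >-> R}.
Hypothesis gaussian_g : gaussian_sequence g.
Context {E : completeNormedModType R[i]}.
Local Open Scope ereal_scope.

Lemma gauss_moment_prefix (s t : seq E) e :
  gauss_moment s e <= gauss_moment (s ++ t) e.
Proof.
by elim: s e => [|x s ih] e; [exact: gauss_moment_nil_le|exact: le_gauss_moment].
Qed.

Lemma second_moment_psum_mono (y : nat -> E) m l : (m <= l)%N ->
  second_moment P (gamma_psum g y m) <= second_moment P (gamma_psum g y l).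
Proof.
move=> ml; rewrite !second_moment_gamma_psum// -(subnKC ml) iotaD map_cat.
exact: gauss_moment_prefix.
Qed.

Lemma gamma_cvg_near (y : nat -> E) S (eps : R) : gamma_cvg g y S -> (0 < eps)%R ->
  \forall n \near \oo, second_moment P (fun w => gamma_psum g y n w - S w)%R <= eps%:E.
Proof.
move=> [_ _ /fine_cvgP[fin /cvgr_le /(_ _)/[apply]]]; apply: filterS2 fin => n nfin nle.
by rewrite -[leLHS]fineK// lee_fin.
Qed.

(** The limit is controlled by its approximations up to a factor 2, since the
    triangle inequality is used in squared form. *)
Lemma gamma_cvg_bound (y : nat -> E) S (c : \bar R) : gamma_cvg g y S ->
  (forall n, second_moment P (gamma_psum g y n) <= c) ->
  second_moment P S <= 2%:E * c.
Proof.
move=> yS yc; have [mS _ _] := yS; apply/lee_addgt0Pr => e e0.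
have e20 : (0 < e / 2)%R by rewrite divr_gt0.
have [n _ /(_ n (leqnn n))/= hn] := gamma_cvg_near yS e20.
have mn := strongly_measurable_gamma_psum g y n.
have := second_momentB P mn (strongly_measurableB mn mS).
under eq_fun do rewrite opprB addrC subrK.
move=> /le_trans; apply; apply: leeD; first by rewrite lee_pmul2l.
rewrite [in leRHS](_ : e%:E = 2%:E * (e / 2)%:E); first by rewrite lee_pmul2l.
by rewrite -EFinM; congr EFin; field.
Qed.

Lemma second_moment_psum_le (y : nat -> E) S m : gamma_cvg g y S ->
  second_moment P (gamma_psum g y m) <= 2%:E * second_moment P S.
Proof.
move=> yS; have [mS _ _] := yS; apply/lee_addgt0Pr => e e0.
have e20 : (0 < e / 2)%R by rewrite divr_gt0.
have [n _ hn] := gamma_cvg_near yS e20.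
have {}hn := hn (maxn n m) (leq_maxl _ _).
apply: le_trans (second_moment_psum_mono y (leq_maxr n m)) _.
have mn := strongly_measurable_gamma_psum g y (maxn n m).
have := second_momentD P mS (strongly_measurableB mn mS).
under eq_fun do rewrite addrC subrK.
move=> /le_trans; apply; rewrite leeD2l//.
rewrite [in leRHS](_ : e%:E = 2%:E * (e / 2)%:E); first by rewrite lee_pmul2l.
by rewrite -EFinM; congr EFin; field.
Qed.

Lemma gamma_cvg_tail (y : nat -> E) S (eps : R) : gamma_cvg g y S -> (0 < eps)%R ->
  exists m, forall l, (m <= l)%N ->
    second_moment P (fun w => gamma_psum g y l w - gamma_psum g y m w)%R <= eps%:E.
Proof.
move=> yS eps0; have [mS _ _] := yS.
have e40 : (0 < eps / 4)%R by rewrite divr_gt0.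
have [m _ hm] := gamma_cvg_near yS e40; exists m => l ml.
have mp n := strongly_measurable_gamma_psum g y n.
have := second_momentB P (strongly_measurableB (mp l) mS) (strongly_measurableB (mp m) mS).
under eq_fun do rewrite opprB addrA subrK.
move=> /le_trans; apply.
rewrite (_ : eps%:E = 2%:E * (eps / 4)%:E + 2%:E * (eps / 4)%:E); last first.
  by rewrite -!EFinM -EFinD; congr EFin; field.
by apply: leeD; rewrite lee_pmul2l//; apply: hm => /=.
Qed.

Lemma gamma_sumP (y : nat -> E) : gamma_converges g y -> gamma_cvg g y (gamma_sum g y).
Proof. exact: xgetPex. Qed.

End ideal_property.

Section ideal_theorem.
Context dO (Om : measurableType dO) (R : realType) (P : probability Om R).
Variable g : nat -> {RV P >-> R}.
Hypothesis gaussian_g : gaussian_sequence g.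
Context {E : completeNormedModType R[i]} {K : innerProductType R}.
Variables (Phi : K -> E) (k : nat -> K) (S : Om -> E).
Hypothesis bPhi : bounded_linear Phi.
Hypothesis kbasis : orthonormal_basis k.
Hypothesis kS : gamma_cvg g (Phi \o k) S.

Let linPhi : {linear K -> E} :=
  HB.pack Phi (GRing.isLinear.Build _ _ _ _ Phi bPhi.1).

Lemma bounded_linear_expansion m x :
  Phi (expansion k m x) = \sum_(j < m) inner x (k j) *: Phi (k j).
Proof.
rewrite -[LHS]/(linPhi _) linear_sum.
by apply: eq_bigr => j _; rewrite linearZ.
Qed.

Lemma bounded_linear_expansion_cvg x :
  Phi (expansion k m x) @[m --> \oo] --> Phi x.
Proof.
have [_ [M PhiM]] := bPhi.
apply/cvgrPdist_lt => e; case: e => e e' /[dup]; rewrite {1}ltcE /= => /andP[/eqP-> e0] _.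
have M0 : 0 < `|M| + 1 by rewrite ltr_pwDr.
have e1 : 0 < e / (`|M| + 1) by rewrite divr_gt0.
apply: filterS (expansion_cvg x kbasis e1) => m hm.
rewrite rnormE ltcR -[Phi x]/(linPhi x) -[Phi _]/(linPhi _) -linearB/=.
apply: le_lt_trans (PhiM _) _.
rewrite ltr_pdivlMr// in hm; apply: le_lt_trans hm; rewrite mulrC.
apply: ler_wpM2l; first exact: inorm_ge0.
by apply: le_trans (ler_norm _) _; rewrite lerDl.
Qed.

Local Open Scope ereal_scope.

Lemma gamma_psum_expansion_cvg (f : nat -> K) N w :
  gamma_psum g (fun n => Phi (expansion k m (f n))) N w @[m --> \oo] -->
  gamma_psum g (Phi \o f) N w.
Proof.
rewrite /gamma_psum; elim: N => [|N ih].
  by under eq_fun do rewrite big_ord0; rewrite big_ord0; exact: cvg_cst.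
under eq_fun do rewrite big_ord_recr; rewrite big_ord_recr/=.
by apply: cvgD => //; apply: cvgZl_tmp; exact: bounded_linear_expansion_cvg.
Qed.

Lemma second_moment_expansion_le (f : nat -> K) M N m : (0 < M)%R ->
  orthogonal_bounded f M ->
  second_moment P (gamma_psum g (fun n => Phi (expansion k m (f n))) N) <=
  (4 * M)%:E * second_moment P (gamma_psum g (Phi \o k) m).
Proof.
move=> M0 fM; under [X in gamma_psum g X]eq_fun do rewrite bounded_linear_expansion.
apply: (second_moment_complex_contraction gaussian_g
  (a := fun n j => inner (f n) (k j)) (Phi \o k) M0) => c.
exact: (bessel_contraction N m c fM (orthonormal_bounded kbasis.1)).
Qed.

(** Expand [f n] in the basis up to order [m], apply the contraction principle to
    the coefficients, and let [m] tend to infinity. *)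
Lemma second_moment_ideal_psum (f : nat -> K) M N : (0 < M)%R ->
  orthogonal_bounded f M ->
  second_moment P (gamma_psum g (Phi \o f) N) <= (8 * M)%:E * second_moment P S.
Proof.
move=> M0 fM; apply: (@second_moment_fatou _ _ _ P _
    (fun m => gamma_psum g (fun n => Phi (expansion k m (f n))) N)).
- by move=> m; exact: strongly_measurable_gamma_psum.
- by move=> w; exact: gamma_psum_expansion_cvg.
apply: nearW => m; apply: le_trans (second_moment_expansion_le N m M0 fM) _.
rewrite (_ : (8 * M)%:E = (4 * M)%:E * 2%:E); last by rewrite -EFinM; congr EFin; ring.
rewrite -muleA; apply: lee_wpmul2l; first by rewrite lee_fin mulr_ge0// ltW.
exact: second_moment_psum_le.
Qed.

Lemma gamma_psumD (x y : nat -> E) N w :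
  gamma_psum g (fun n => x n + y n)%R N w = (gamma_psum g x N w + gamma_psum g y N w)%R.
Proof. by rewrite /gamma_psum -big_split/=; apply: eq_bigr => n _; rewrite scalerDr. Qed.

Lemma gamma_psum_tail (x : nat -> E) p q w : (p <= q)%N ->
  (gamma_psum g x q w - gamma_psum g x p w =
  gamma_psum g (fun n => if (p <= n)%N then x n else 0) q w)%R.
Proof.
move=> pq; rewrite /gamma_psum.
pose F n := ((g n w)%:C *: x n)%R.
pose G n := ((g n w)%:C *: (if (p <= n)%N then x n else 0))%R.
rewrite -(big_mkord xpredT F) -(big_mkord xpredT F) -(big_mkord xpredT G).
rewrite (big_cat_nat (n := p))//= [RHS](big_cat_nat (n := p))//=.
rewrite [X in _ = (X + _)%R]big_nat [X in _ = (X + _)%R]big1 ?add0r => [|i /andP[_ ip]]; last first.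
  by rewrite /G leqNgt ip scaler0.
rewrite addrAC subrr add0r; apply: eq_big_nat => i /andP[pi _].
by rewrite /F /G pi.
Qed.

(** A bound on the partial sums does not give convergence in a general Banach
    space. Split the expansion of [f n] at an index [m]. Beyond [m], the
    contraction principle bounds the contribution by a tail of the convergent
    series along [k]. Up to [m], the finitely many coefficients
    [<f n, k j>] are square summable in [n] by Bessel's inequality, so the
    coefficient matrix of the tail in [n] has a small Hilbert-Schmidt norm, hence
    a small operator norm. *)
Lemma gamma_psum_ideal_cauchy (f : nat -> K) M (eps : R) : (0 < M)%R ->
  orthogonal_bounded f M -> (0 < eps)%R ->
  exists N, forall p q, (N <= p)%N -> (p <= q)%N ->
    second_moment P (fun w => gamma_psum g (Phi \o f) q w - gamma_psum g (Phi \o f) p w)%R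
    <= eps%:E.
Proof.
move=> M0 fM eps0; set y := Phi \o k.
have e10 : (0 < eps / (16 * M))%R by rewrite divr_gt0// mulr_gt0.
have [m hm] := gamma_cvg_tail kS e10.
have Vfin : second_moment P (gamma_psum g y m) \is a fin_num.
  rewrite ge0_fin_numE ?second_moment_ge0//.
  apply: le_lt_trans (second_moment_psum_le gaussian_g m kS) _.
  by apply: lte_mul_pinfty => //; case: kS.
set v := fine (second_moment P (gamma_psum g y m)).
have v0 : (0 <= v)%R by rewrite fine_ge0// second_moment_ge0.
have vE : second_moment P (gamma_psum g y m) = v%:E by rewrite fineK.
have d0 : (0 < eps / (16 * (v + 1)))%R by rewrite divr_gt0// mulr_gt0// ltr_pwDr.
pose wt n := (\sum_(j < m) sqmod (inner (f n) (k j)))%R.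
have wt0 n : (0 <= wt n)%R by apply: sumr_ge0 => j _; exact: sqmod_ge0.
have wtB N : (\sum_(n < N) wt n <= \sum_(j < m) M * 1)%R.
  rewrite exchange_big; apply: ler_sum => j _.
  under eq_bigr do rewrite inner_conj sqmod_conj.
  apply: le_trans (bessel N (k j) M0 fM) _.
  by rewrite ler_pM2l//; case: (orthonormal_bounded kbasis.1).
have [N hN] := bounded_series_tail wt0 wtB d0.
exists N => p q Np pq.
under eq_fun do rewrite gamma_psum_tail//.
pose f' n := if (p <= n)%N then f n else 0%R.
have f'M : orthogonal_bounded f' M.
  case: fM => oF bF; split=> [i j ij|i]; rewrite /f'.
    by case: ifP => _; case: ifP => _; rewrite ?inner0l ?inner0r ?oF.
  by case: ifP => _; rewrite ?bF// sqnorm0 ltW.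
rewrite (_ : (fun n => if (p <= n)%N then (Phi \o f) n else 0%R) = Phi \o f'); last first.
  apply/funext => n; rewrite /f' /=; case: ifP => // _.
  by rewrite -[RHS]/(linPhi 0%R) linear0.
apply: (@second_moment_fatou _ _ _ P _
    (fun l => gamma_psum g (fun n => Phi (expansion k l (f' n))) q)).
- by move=> l; exact: strongly_measurable_gamma_psum.
- by move=> w; exact: gamma_psum_expansion_cvg.
exists m => // l /= ml.
pose a n j := inner (f' n) (k j).
pose yt j := if (m <= j)%N then y j else 0%R.
have -> : gamma_psum g (fun n => Phi (expansion k l (f' n))) q =
    (fun w => gamma_psum g (fun n => \sum_(j < m) a n j *: y j)%R q w +
              gamma_psum g (fun n => \sum_(j < l) a n j *: yt j)%R q w)%R.
  apply/funext => w; rewrite -gamma_psumD; congr gamma_psum; apply/funext => n.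
  rewrite bounded_linear_expansion -(big_mkord xpredT (fun j => a n j *: y j)%R).
  rewrite -(big_mkord xpredT (fun j => a n j *: yt j)%R).
  rewrite -(big_mkord xpredT (fun j => inner (f' n) (k j) *: Phi (k j))%R).
  rewrite (big_cat_nat (n := m))//=; congr (_ + _)%R.
  rewrite [RHS](big_cat_nat (n := m))//= big_nat.
  rewrite [X in _ = (X + _)%R]big_nat [X in _ = (X + _)%R]big1 ?add0r; last first.
    by move=> j /andP[_ jm]; rewrite /yt leqNgt jm scaler0.
  by rewrite -big_nat; apply: eq_big_nat => j /andP[mj _]; rewrite /yt mj.
apply: le_trans (second_momentD P (strongly_measurable_gamma_psum g _ _)
  (strongly_measurable_gamma_psum g _ _)) _.
have h1 : second_moment P (gamma_psum g (fun n => \sum_(j < m) a n j *: y j)%R q) <=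
    (4 * (eps / (16 * (v + 1))))%:E * v%:E.
  rewrite -vE; apply: (second_moment_complex_contraction gaussian_g (a := a) y d0) => c.
  apply: (@le_trans _ _ (\sum_(j < m) (\sum_(n < q) c n ^+ 2) *
      (\sum_(n < q) sqmod (a n j)))%R).
    by apply: ler_sum => j _; exact: (sqmod_sum_le q c (a ^~ j)).
  rewrite -mulr_sumr mulrC; apply: ler_wpM2r.
    by apply: sumr_ge0 => n _; exact: sqr_ge0.
  rewrite exchange_big; apply: le_trans (hN p q Np).
  apply: ler_sum => n _; rewrite /a /f'; case: ifP => // _.
  by rewrite big1// => j _; rewrite inner0l /sqmod expr0n/= addr0.
have h2 : second_moment P (gamma_psum g (fun n => \sum_(j < l) a n j *: yt j)%R q) <=
    (4 * M)%:E * (eps / (16 * M))%:E.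
  apply: (@le_trans _ _ ((4 * M)%:E * second_moment P (gamma_psum g yt l))).
    apply: (second_moment_complex_contraction gaussian_g (a := a) yt M0) => c.
    exact: (bessel_contraction q l c f'M (orthonormal_bounded kbasis.1)).
  apply: lee_wpmul2l; first by rewrite lee_fin mulr_ge0// ltW.
  by have := hm l ml; under eq_fun do rewrite gamma_psum_tail//.
apply: (@le_trans _ _ (2%:E * ((4 * (eps / (16 * (v + 1))))%:E * v%:E) +
    2%:E * ((4 * M)%:E * (eps / (16 * M))%:E))).
  by apply: leeD; rewrite lee_pmul2l.
rewrite -!EFinM -EFinD lee_fin.
have -> : (2 * (4 * M * (eps / (16 * M))) = eps / 2)%R by field; rewrite gt_eqF.
have v1 : (v / (v + 1) <= 1)%R by rewrite ler_pdivrMr ?ltr_pwDr// mul1r lerDl.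
have -> : (2 * (4 * (eps / (16 * (v + 1))) * v) = eps / 2 * (v / (v + 1)))%R.
  by field; rewrite gt_eqF// ltr_pwDr.
have : (eps / 2 * (v / (v + 1)) <= eps / 2)%R by rewrite ler_piMr// divr_ge0// ltW.
by lra.
Qed.

(** An orthogonal sequence of vectors of squared norm at most [M] is the image of
    an orthonormal one under an operator of norm at most [sqrt M], so this is the
    ideal property of gamma-radonifying operators. *)
Lemma gamma_ideal (f : nat -> K) M : (0 < M)%R -> orthogonal_bounded f M ->
  gamma_converges g (Phi \o f) /\
  second_moment P (gamma_sum g (Phi \o f)) <= (16 * M)%:E * second_moment P S.
Proof.
move=> M0 fM.
have bnd N := second_moment_ideal_psum N M0 fM.
have cv : gamma_converges g (Phi \o f).
  have [|||X [mX Xoo cX]] := @second_moment_complete _ _ _ P _ (gamma_psum g (Phi \o f)).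
  - by move=> n; exact: strongly_measurable_gamma_psum.
  - move=> n; apply: le_lt_trans (bnd n) _; apply: lte_mul_pinfty => //.
      by rewrite lee_fin mulr_ge0// ltW.
    by case: kS.
  - move=> eps eps0; have [N hN] := gamma_psum_ideal_cauchy M0 fM eps0.
    exists N => p q Np Nq; have [pq|/ltnW qp] := leqP p q; last exact: hN.
    by rewrite second_moment_distC; exact: hN.
  by exists X.
split=> //; apply: le_trans (gamma_cvg_bound (gamma_sumP cv) bnd) _.
by rewrite muleA -EFinM (_ : 2 * (8 * M) = 16 * M)%R//; ring.
Qed.

End ideal_theorem.

(** * Exponential tensors *)

Section laplace_vectors.
Context {R : realType} {H : hilbertType R}.
Implicit Types (lam : R[i]) (h : H).
Local Notation mu := (@Rplus_measure R).

Definition exp_tensor lam h : L2Rplus H := toL2 mu (fun t => e_ lam t *: h).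

Lemma inner_toL2 (u v : R -> H) : square_integrable mu u -> square_integrable mu v ->
  inner (toL2 mu u) (toL2 mu v) = cintegral mu (fun t => inner (u t) (v t)).
Proof.
move=> su sv; rewrite -[LHS]/(innerL2 _ _) /toL2 innerL2E.
by rewrite !insubdK//; exact/asboolP.
Qed.

Lemma exp_tensor_lin lam (a : R[i]) h h' : 0 < complex.Re lam ->
  exp_tensor lam (a *: h + h') = a *: exp_tensor lam h + exp_tensor lam h'.
Proof.
move=> l0; have sq x := square_integrable_e_tensor (lam := lam) x l0.
rewrite /exp_tensor /toL2 pi_L2_lin; congr (\pi_(L2 mu H) _)%qT.
apply: val_inj; rewrite insubdK; last exact/asboolP.
rewrite linearP/= !insubdK; [|exact/asboolP|exact/asboolP].
by apply/funext => t; rewrite !fctE scalerDr !scalerA mulrC.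
Qed.

(** Orthogonality in [H] alone suffices, whatever the two exponentials are; this
    is what makes different operators along a basis of [H] tractable. *)
Lemma inner_exp_tensor0 lam lam' h h' : 0 < complex.Re lam -> 0 < complex.Re lam' ->
  inner h h' = 0 :> R[i] -> inner (exp_tensor lam h) (exp_tensor lam' h') = 0 :> R[i].
Proof.
move=> l0 l0' hh'; rewrite inner_toL2; try exact: square_integrable_e_tensor.
rewrite (_ : (fun t => _) = fun=> 0); last first.
  by apply/funext => t; rewrite innerZl innerZr hh' !mulr0.
by rewrite /cintegral/= /Rintegral integral0.
Qed.

(** [\int_0^oo |e_lam t|^2 dt = 1 / (2 Re lam)], read off from the total mass of
    the exponential distribution of rate [2 Re lam]. *)
Lemma sqnorm_exp_tensor lam h : 0 < complex.Re lam ->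
  sqnorm (exp_tensor lam h) <= (2 * complex.Re lam)^-1 * sqnorm h.
Proof.
move=> l0; rewrite /sqnorm inner_toL2; try exact: square_integrable_e_tensor.
set c := complex.Re lam in l0 *.
have r0 : 0 < 2 * c by rewrite mulr_gt0.
have D0 : 0 <= (2 * c)^-1 * sqnorm h by rewrite mulr_ge0 ?invr_ge0 ?(ltW r0) ?sqnorm_ge0.
have mf : measurable_fun setT (fun t : R => (expR (- (c * t)) * rnorm h) ^+ 2).
  apply: measurable_funX; apply: measurable_funM => //.
  by apply: measurableT_comp => //; apply: measurableT_comp => //; exact: measurable_funM.
rewrite /cintegral /= /Rintegral.
have -> : (\int[mu]_t (complex.Re (inner (e_ lam t *: h) (e_ lam t *: h)))%:E =
    \int[mu]_t ((expR (- (c * t)) * rnorm h) ^+ 2)%:E)%E.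
  by apply: eq_integral => t _; rewrite inner_rnorm/= rnormZ normr_e_.
suff I : (\int[mu]_t ((expR (- (c * t)) * rnorm h) ^+ 2)%:E <=
    ((2 * c)^-1 * sqnorm h)%:E)%E.
  rewrite -lee_fin fineK// ge0_fin_numE; first exact: le_lt_trans I (ltry _).
  by apply: integral_ge0 => t _; rewrite lee_fin sqr_ge0.
rewrite ge0_integral_Rplus; last 2 first.
  exact/measurable_EFinP.
  by move=> t; rewrite lee_fin sqr_ge0.
have mpdf : measurable_fun setT (fun t : R => (exponential_pdf (2 * c) t)%:E).
  by apply/measurable_EFinP; exact: measurable_exponential_pdf.
have pdf0 t : (0 <= (exponential_pdf (2 * c) t)%:E)%E.
  by rewrite lee_fin exponential_pdf_ge0// ltW.
have -> : (\int[lebesgue_measure]_(t in `[0%R, +oo[) ((expR (- (c * t)) * rnorm h) ^+ 2)%:E =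
    \int[lebesgue_measure]_(t in `[0%R, +oo[)
      (((2 * c)^-1 * sqnorm h)%:E * (exponential_pdf (2 * c) t)%:E))%E.
  apply: eq_integral => t; rewrite inE/= in_itv/= andbT => t0; rewrite exponential_pdfE//.
  rewrite -EFinM; congr EFin.
  rewrite /sqnorm inner_rnorm /= (_ : - (2 * c) * t = - (c * t) + - (c * t)); last by ring.
  by rewrite expRD; field; rewrite lt0r_neq0.
rewrite ge0_integralZl_EFin//; last exact: measurable_funTS.
rewrite -[leRHS]mule1 lee_wpmul2l ?lee_fin// -(integral_exponential_pdf r0).
by apply: ge0_subset_integral => //; exact: measurable_itv.
Qed.

End laplace_vectors.

(** * Existence of an orthonormal basis *)

Section orthonormal_basis_existence.
Context {R : realType} {H : hilbertType R}.

Lemma inorm_rnorm (x : H) : inorm x = rnorm x.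
Proof. by rewrite /inorm inner_rnorm/= sqrtr_sqr ger0_norm// rnorm_ge0. Qed.

Lemma dense_sequence : separable_space H ->
  exists d : nat -> H, forall (x : H) (eps : R), 0 < eps ->
    exists n, inorm (x - d n) < eps.
Proof.
move=> [D cD dD].
have [f injf] : exists f : H -> nat, {in D &, injective f}.
  by have /pcard_leTP/= [f] := cD; exists f => x y xD yD; exact: inj.
exists (fun n => xget 0 [set x | D x /\ f x = n]) => x eps eps0.
have e0 : 0 < eps%:C :> R[i] by rewrite ltcR.
have [] := dD (ball x eps%:C)° _ (open_interior _).
  by exists x; exact: nbhsx_ballx.
move=> y [/interior_subset + Dy]; rewrite -ball_normE /ball_ /= rnormE ltcR => xy.
exists (f y); rewrite inorm_rnorm; case: xgetP => [z _ [Dz zy]|/(_ y)[]//].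
by rewrite (injf z y)// inE.
Qed.

Variable d : nat -> H.

Definition residual (s : seq H) (x : H) : H := x - \sum_(e <- s) inner x e *: e.

(** Taking the least index with a nonzero residual ensures that, after [j] steps,
    the first [j] vectors of the dense sequence lie in the span. *)
Definition first_index (s : seq H) : nat :=
  xget 0%N [set n | residual s (d n) != 0 /\
    forall m, (m < n)%N -> residual s (d m) = 0].

Definition next_vector (s : seq H) : H :=
  let y := residual s (d (first_index s)) in (inorm y)^-1%:C *: y.

Fixpoint gram_schmidt (j : nat) : seq H :=
  if j is j'.+1 then rcons (gram_schmidt j') (next_vector (gram_schmidt j')) else [::].

Let k j := next_vector (gram_schmidt j).

Lemma residual_expansion j x : residual (gram_schmidt j) x = x - expansion k j x.
Proof.
congr (_ - _); rewrite /expansion; elim: j => [|j ih] /=; first by rewrite big_nil big_ord0.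
by rewrite big_rcons/= ih big_ord_recr.
Qed.

Hypothesis infdim : infinite_dimensional H.
Hypothesis densd : forall (x : H) (eps : R), 0 < eps -> exists n, inorm (x - d n) < eps.

Let orthonormal_upto j := forall i i', (i < j)%N -> (i' < j)%N ->
  inner (k i) (k i') = (i == i')%:R :> R[i].

(** A finite orthonormal family whose span contains a dense sequence spans the
    whole space, as its span is closed. *)
Lemma exists_nonzero_residual j : orthonormal_upto j ->
  exists n, residual (gram_schmidt j) (d n) != 0.
Proof.
move=> oj; apply: contrapT => /forallNP all0.
have {}all0 n : d n = expansion k j (d n).
  apply/eqP; rewrite -subr_eq0 -residual_expansion.
  by apply: contrapT => /negP h; exact: (all0 n).
have [x xN] := infdim (fun i : 'I_j => k i).
apply: (xN (fun i => inner x (k i))); apply/eqP; rewrite -subr_eq0.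
rewrite -[X in _ - X]/(expansion k j x); apply: contrapT => /negP x0.
have e0 : 0 < inorm (x - expansion k j x).
  by rewrite /inorm sqrtr_gt0; have := inner_gt0 _ x0; rewrite ltcE => /andP[].
have [n hn] := densd x e0.
have := expansion_best x (fun i : 'I_j => inner (d n) (k i)) oj (leqnn j).
by rewrite -/(expansion k j (d n)) -all0 leNgt hn.
Qed.

Lemma first_indexP j : orthonormal_upto j ->
  residual (gram_schmidt j) (d (first_index (gram_schmidt j))) != 0 /\
  forall m, (m < first_index (gram_schmidt j))%N -> residual (gram_schmidt j) (d m) = 0.
Proof.
move=> /exists_nonzero_residual ex; rewrite /first_index; case: xgetP => [n _ []//|no].
have [n rn nmin] := ex_minnP ex; case: (no n); split => // m mn.
by apply/eqP; apply: contraTT mn => /nmin; rewrite -leqNgt.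
Qed.

Lemma gram_schmidt_orthonormal j : orthonormal_upto j.
Proof.
elim: j => [i i'|j oj i i']; first by rewrite ltn0.
rewrite !ltnS (leq_eqVlt i) (leq_eqVlt i').
set y := residual (gram_schmidt j) (d (first_index (gram_schmidt j))).
have [y0 _] := first_indexP oj; rewrite -/y in y0.
have kj : k j = (inorm y)^-1%:C *: y by [].
have ny : inorm y != 0.
  rewrite inorm_rnorm; apply: contra y0 => /eqP ry.
  by apply/eqP; apply: rnorm_le0; rewrite ry.
have orth l : (l < j)%N -> inner (k j) (k l) = 0 :> R[i].
  move=> lj; rewrite kj innerZl /y residual_expansion expansion_residual ?mulr0//.
have nk : inner (k j) (k j) = 1 :> R[i].
  rewrite kj innerZl innerZr inner_sqnorm -sqr_inorm conjc_real -!rmorphM/=.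
  by rewrite (_ : _ * _ = 1) //; field.
move=> /predU1P[->|ij] /predU1P[->|i'j].
- by rewrite eqxx nk.
- by rewrite orth// gtn_eqF.
- by rewrite inner_conj orth// conjc0 ltn_eqF.
- exact: oj.
Qed.

Lemma expansion_gram_schmidt m j : (m < j)%N -> d m = expansion k j (d m).
Proof.
have ok i i' : inner (k i) (k i') = (i == i')%:R :> R[i].
  by apply: (@gram_schmidt_orthonormal (maxn i i').+1); rewrite ltnS ?leq_maxl ?leq_maxr.
have oj l : orthonormal_upto l by exact: gram_schmidt_orthonormal.
have persist l x : x = expansion k l x -> x = expansion k l.+1 x.
  move=> xj; rewrite /expansion big_ord_recr/= -/(expansion k l x) -xj.
  have -> : inner x (k l) = 0 :> R[i]; last by rewrite scale0r addr0.
  rewrite xj /expansion (inner_suml _ (fun i => inner x (k i))) big1// => i _.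
  by rewrite ok ltn_eqF ?mulr0.
elim: j m => [|j ih] m; first by rewrite ltn0.
rewrite ltnS leq_eqVlt => /predU1P[->|mj]; last exact/persist/ih.
have [r0|rj] := eqVneq (residual (gram_schmidt j) (d j)) 0.
  by apply: persist; apply/eqP; rewrite -subr_eq0 -residual_expansion r0.
have [n0r n0min] := first_indexP (oj j); set n0 := first_index _ in n0r n0min.
have n0j : n0 = j.
  apply/eqP; rewrite eqn_leq; apply/andP; split; rewrite leqNgt; apply/negP => h.
    by rewrite n0min ?eqxx in rj.
  move: n0r; rewrite residual_expansion subr_eq0 => /eqP; apply.
  exact: ih.
set y := residual (gram_schmidt j) (d j) in rj.
have kj : k j = (inorm y)^-1%:C *: y by rewrite /k /next_vector -/n0 n0j.
have ny : inorm y != 0.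
  rewrite inorm_rnorm; apply: contra rj => /eqP ry.
  by apply/eqP; apply: rnorm_le0; rewrite ry.
have dj : d j = expansion k j (d j) + y by rewrite /y residual_expansion addrC subrK.
rewrite {1}dj {2}/expansion big_ord_recr/= -/(expansion k j (d j)); congr (_ + _).
have -> : inner (d j) (k j) = (inorm y)%:C.
  rewrite dj innerDl {1}/expansion (inner_suml _ (fun i => inner (d j) (k i))).
  rewrite big1 ?add0r => [|i _]; last by rewrite ok ltn_eqF ?mulr0.
  rewrite kj innerZr inner_sqnorm -sqr_inorm conjc_real -rmorphM/=.
  by congr (_%:C); field.
by rewrite kj scalerA -rmorphM/= divff// scale1r.
Qed.

Lemma gram_schmidt_basis : orthonormal_basis k.
Proof.
split=> [i i'|x eps eps0].
  by apply: (@gram_schmidt_orthonormal (maxn i i').+1); rewrite ltnS ?leq_maxl ?leq_maxr.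
have [n hn] := densd x eps0.
exists n.+1, (fun i => inner (d n) (k i)).
by rewrite -/(expansion k n.+1 (d n)) -expansion_gram_schmidt.
Qed.

End orthonormal_basis_existence.

Lemma exists_orthonormal_basis (R : realType) (H : hilbertType R) :
  separable_space H -> infinite_dimensional H ->
  exists k : nat -> H, orthonormal_basis k.
Proof.
move=> /dense_sequence[d dd] infH; eexists; exact: (gram_schmidt_basis infH dd).
Qed.

(** * The Laplace transform *)

Section laplace_family_bounds.
Context {R : realType} {H : hilbertType R} {E : completeNormedModType R[i]}.
Variable Phi : L2Rplus H -> E.

Lemma laplace_bounded_linear lam : bounded_linear Phi -> 0 < complex.Re lam ->
  bounded_linear (laplace Phi lam).
Proof.
move=> [linPhi [M PhiM]] l0; split.
  move=> a x y; rewrite /laplace -!/(exp_tensor _ _).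
  by rewrite exp_tensor_lin// linPhi.
exists (`|M| * Num.sqrt (2 * complex.Re lam)^-1) => h.
apply: le_trans (PhiM _) _.
apply: (@le_trans _ _ (`|M| * inorm (exp_tensor lam h))).
  by apply: ler_wpM2r; [exact: inorm_ge0|exact: ler_norm].
rewrite -mulrA; apply: ler_wpM2l => //.
rewrite /inorm -sqrtrM ?invr_ge0 ?mulr_ge0 ?(ltW l0)//.
by apply: ler_wsqrtr; exact: sqnorm_exp_tensor.
Qed.

Lemma exp_tensor_orthogonal_bounded (b : R) (h : nat -> H) (lam : nat -> R[i]) :
  0 < b -> (forall i j, inner (h i) (h j) = (i == j)%:R :> R[i]) ->
  (forall j, b <= complex.Re (lam j)) ->
  orthogonal_bounded (fun j => exp_tensor (lam j) (h j)) (2 * b)^-1.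
Proof.
move=> b0 oh bl; have l0 j : 0 < complex.Re (lam j) := lt_le_trans b0 (bl j).
split=> [i j /negbTE ij|j]; first by rewrite inner_exp_tensor0// oh ij.
apply: le_trans (sqnorm_exp_tensor _ (l0 j)) _.
rewrite /sqnorm oh eqxx /= mulr1 lef_pV2 ?posrE ?mulr_gt0//.
by rewrite ler_pM2l.
Qed.

Lemma laplace_familyP (b : R) (T : nat -> H -> E) :
  (forall j, laplace_family Phi b (T j)) ->
  exists2 lam : nat -> R[i], (forall j, b <= complex.Re (lam j)) &
    forall j, T j = laplace Phi (lam j).
Proof.
move=> hT; have /choice[lam hl] : forall j, exists l, b <= complex.Re l /\ laplace Phi l = T j.
  by move=> j; have [l bl <-] := hT j; exists l.
by exists lam => j; have [] := hl j.
Qed.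

End laplace_family_bounds.

Theorem theorem4p7 (R : realType) :
  exists C : R,
  forall (dO : measure_display) (Om : measurableType dO) (P : probability Om R)
    (g : nat -> {RV P >-> R}) (H : hilbertType R)
    (E : completeNormedModType R[i]) (Phi : L2Rplus H -> E),
  gaussian_sequence g ->
  separable_space H ->
  infinite_dimensional H ->
  gamma_radonifying g Phi ->
  forall b : R, 0 < b ->
  [/\ forall T, laplace_family Phi b T -> gamma_radonifying g T,
      unif_gamma_radonifying g (laplace_family Phi b) &
      forall k : nat -> L2Rplus H, orthonormal_basis k ->
        (unif_gamma_norm g (laplace_family Phi b)
           <= (C / Num.sqrt b)%:E * gamma_norm g k Phi)%E].
Proof.
exists (Num.sqrt 8) => dO Om P g H E Phi gaussian_g sepH infH [bPhi [k0 k0basis [S0 k0S]]] b b0.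
have B0 : 0 < (2 * b)^-1 by rewrite invr_gt0 mulr_gt0.
(* any basis of L^2(R_+; H) can be used in place of [k0] *)
have kcv k : orthonormal_basis k -> gamma_converges g (Phi \o k).
  move=> kbasis.
  by have [] := gamma_ideal gaussian_g bPhi k0basis k0S ltr01 (orthonormal_bounded kbasis.1).
have unif k (h : nat -> H) (T : nat -> H -> E) : orthonormal_basis k ->
    orthonormal_basis h -> (forall j, laplace_family Phi b (T j)) ->
    gamma_converges g (fun j => T j (h j)) /\
    (second_moment P (gamma_sum g (fun j => T j (h j))) <=
      (8 / b)%:E * second_moment P (gamma_sum g (Phi \o k)))%E.
  move=> kbasis hbasis /laplace_familyP[lam bl Tl].
  have fb := exp_tensor_orthogonal_bounded b0 hbasis.1 bl.
  rewrite (_ : (fun j => T j (h j)) = Phi \o (fun j => exp_tensor (lam j) (h j))); last first.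
    by apply/funext => j; rewrite Tl.
  have := gamma_ideal gaussian_g bPhi kbasis (gamma_sumP (kcv _ kbasis)) B0 fb.
  by rewrite (_ : 16 * (2 * b)^-1 = 8 / b)//; field; rewrite gt_eqF.
have bounded T : laplace_family Phi b T -> bounded_linear T.
  move=> [lam bl <-]; apply: laplace_bounded_linear => //; exact: lt_le_trans bl.
split.
- move=> T FT; split; first exact: bounded.
  have [h hbasis] := exists_orthonormal_basis sepH infH.
  by exists h => //; have [] := unif k0 h (fun=> T) k0basis hbasis (fun=> FT).
- split=> [//|h T hbasis FT].
  by have [] := unif k0 h T k0basis hbasis FT.
move=> k kbasis; rewrite /unif_gamma_norm /gamma_norm.
set V := second_moment P (gamma_sum g (Phi \o k)).
have V0 : (0 <= V)%E by exact: second_moment_ge0.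
have -> : ((Num.sqrt 8 / Num.sqrt b)%:E = sqrte (8 / b)%:E)%E.
  by rewrite /= sqrtrM// sqrtrV// ltW.
rewrite -sqrteM; last by rewrite lee_fin divr_ge0// ltW.
rewrite lee_sqrt; last by rewrite mule_ge0// lee_fin divr_ge0// ltW.
apply: ge_ereal_sup => _ [h [T [hbasis FT ->]]].
by have [] := unif k h T kbasis hbasis FT.
Qed.
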